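(* Let $Z$ be a $[0,1]$-valued random variable such that $\mathbb{E}Z\neq 1/2$. Then $Z$ has a Beta distribution if and only if there exist a $[0,1]$-valued random variable $W$, independent of $Z$, with $\mathbb{E}W\in(0,1)$, and a number $p\in(0,1)\setminus\{1/2\}$ such that $$ \mathbb{E}\,g(Z)Z=p\,\mathbb{E}\,g((1-W)Z+W),\qquad \mathbb{E}\,g(Z)(1-Z)=(1-p)\,\mathbb{E}\,g((1-W)Z) $$ for all measurable $g\colon[0,1]\to[0,\infty)$. In this case $Z$ has the $\mathrm{Beta}(p\alpha,(1-p)\alpha)$ distribution and $W$ has the $\mathrm{Beta}(1,\alpha)$ distribution, where $\alpha=(1-\mathbb{E}W)/\mathbb{E}W$.
   Context: For $\alpha,\beta>0$, $\mathrm{Beta}(\alpha,\beta)$ is the probability measure on $[0,1]$ with Lebesgue density $x\mapsto B(\alpha,\beta)^{-1}x^{\alpha-1}(1-x)^{\beta-1}$, where $B(\alpha,\beta)=\Gamma(\alpha)\Gamma(\beta)/\Gamma(\alpha+\beta)$. ''$Z$ has a Beta distribution'' means that its law is $\mathrm{Beta}(\alpha,\beta)$ for some $\alpha,\beta>0$. The existence of the independent random variable $W$ is understood up to enlarging the underlying probability space; equivalently, it is the existence of a probability measure (the law of $W$) on $[0,1]$ such that the identities hold with $(Z,W)$ having the product law. *)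

(* Defs.v *)
From HB Require Import structures.
From mathcomp Require Import all_boot all_order all_algebra.
From mathcomp Require Import all_classical all_reals all_analysis.

Set Implicit Arguments.
Unset Strict Implicit.
Unset Printing Implicit Defensive.

Import Order.TTheory GRing.Theory Num.Theory.
Import numFieldNormedType.Exports.

Local Open Scope classical_set_scope.
Local Open Scope ring_scope.

Definition Gamma (R : realType) (a : R) : R :=
  \int[lebesgue_measure]_(t in `]0, +oo[) (t `^ (a - 1) * expR (- t)).

Definition Beta (R : realType) (a b : R) : R :=
  Gamma a * Gamma b / Gamma (a + b).

(* mathcomp-analysis's beta_pdf and beta_prob only take parameters in nat. *)
Definition Beta_density (R : realType) (a b x : R) : R :=
  (Beta a b)^-1 * (x `^ (a - 1) * (1 - x) `^ (b - 1)).

Definition Beta_law (R : realType) (a b : R) (A : set R) : \bar R :=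
  (\int[lebesgue_measure]_(x in A `&` `[0%R, 1%R]) (Beta_density a b x)%:E)%E.

Definition Beta_distributed (R : realType) (d : measure_display)
    (T : measurableType d) (P : probability T R) (X : {RV P >-> R})
    (a b : R) : Prop :=
  forall A : set R, measurable A -> distribution P X A = Beta_law a b A.
Arguments Beta_distributed {R d T} P X a b.

Definition independent_rv (R : realType) (d : measure_display)
    (T : measurableType d) (P : probability T R) (X Y : T -> R) : Prop :=
  forall A B : set R, measurable A -> measurable B ->
    P (X @^-1` A `&` Y @^-1` B) = (P (X @^-1` A) * P (Y @^-1` B))%E.

(* (T', P') enlarges (T, P) through the projection pi; a random variable X on
   (T, P) is read on (T', P') as X \o pi. *)
Definition enlargement (R : realType) (d d' : measure_display)
    (T : measurableType d) (T' : measurableType d')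
    (P : probability T R) (P' : probability T' R) (pi : {mfun T' >-> T}) : Prop :=
  forall A : set T, measurable A -> distribution P' pi A = P A.

(* A measurable g : [0,1] -> [0,oo) is a function on R constrained on [0,1]
   only; this is harmless since g is evaluated only at points of [0,1] when Z
   and W are [0,1]-valued. Both sides may be +oo. *)
Definition size_bias_identities (R : realType) (d : measure_display)
    (T : measurableType d) (P : probability T R) (Z W : T -> R) (p : R) : Prop :=
  forall g : R -> R,
    measurable_fun (`[0, 1] : set R) g -> (forall x, x \in `[0, 1] -> 0 <= g x) ->
    ('E_P[fun t => (g (Z t) * Z t)%R]
       = p%:E * 'E_P[fun t => g ((1 - W t) * Z t + W t)%R])%E /\
    ('E_P[fun t => (g (Z t) * (1 - Z t))%R]
       = (1 - p)%:E * 'E_P[fun t => g ((1 - W t) * Z t)%R])%E.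

Definition characterizing_pair (R : realType) (d d' : measure_display)
    (T : measurableType d) (T' : measurableType d')
    (P : probability T R) (P' : probability T' R) (pi : {mfun T' >-> T})
    (Z : {RV P >-> R}) (W : {RV P' >-> R}) (p : R) : Prop :=
  [/\ forall t, W t \in `[0, 1],
      independent_rv P' (Z \o pi) W,
      (0 < 'E_P'[W] < 1)%E,
      0 < p < 1 /\ p <> 1 / 2 &
      size_bias_identities P' (Z \o pi) W p].
Arguments characterizing_pair {R d d' T T'} P P' pi Z W p.

(* Main.v *)
Require Import Defs.
From HB Require Import structures.
From mathcomp Require Import all_boot all_order all_algebra.
From mathcomp Require Import all_classical all_reals all_analysis.
From mathcomp Require Import measurable_realfun.
From mathcomp Require Import ring lra.

(** Put [e i j = E(Z^i (1 - Z)^j)] and [c n = E(1 - W)^n]. Trivially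
    [e (i+1) j + e i (j+1) = e i j], and the two identities with [g x = (1 - x)^n] and
    [g x = x^n] read [e 1 n = p (c n) (e 0 n)] and [e n 1 = (1 - p) (c n) (e n 0)]. Since
    [p <> 1/2], these relations determine the whole array [e] and all the [c n] from
    [c 1 = 1 - E W], and the moments of [Z ~ Beta(p al, (1 - p) al)] and [W ~ Beta(1, al)]
    solve them. A law on [0, 1] is determined by its moments. Conversely, each identity says
    that two weighted laws on [0, 1] agree, which by the same moment principle only has to be
    checked for [g x = (1 - x)^n], respectively [g x = x^n]. *)

Import Order.TTheory GRing.Theory Num.Theory.
Import numFieldNormedType.Exports.

Local Open Scope classical_set_scope.
Local Open Scope ring_scope.

(** * Moments of beta laws *)

Section pochhammer.
Context {R : realFieldType}.
Implicit Types (a b p c : R).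

(** The first identity is tested on powers of [1 - x] because
    [1 - ((1 - W) Z + W) = (1 - W) (1 - Z)]: after this reflection both right-hand sides involve a
    product of independent factors, so their moments split. The numbers [c n] are unknown too, and
    each antidiagonal has to fix one of them besides its own entries. The equation for [c 1] is
    void, which is why [E W] remains a free parameter; [al] is the solution of
    [c 1 = al / (al + 1)]. [Gamma] and [Beta] are real numbers extracted from extended-real
    integrals, so finiteness, positivity and the relation between the two integrals must be
    established before the Beta density has usable moments. Laws may have atoms, so moment
    determinacy rests on polynomials [(1 - x^n)^N] that converge to indicators of open half-lines at
    every point of [[0, 1]], the threshold included. *)

Definition pochhammer (a : R) (n : nat) : R := \prod_(k < n) (a + k%:R).

Lemma pochhammer0 a : pochhammer a 0 = 1.
Proof. by rewrite /pochhammer big_ord0. Qed.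

Lemma pochhammerS a n : pochhammer a n.+1 = pochhammer a n * (a + n%:R).
Proof. by rewrite /pochhammer big_ord_recr. Qed.

Lemma pochhammer_gt0 a n : 0 < a -> 0 < pochhammer a n.
Proof. by move=> a0; apply: prodr_gt0 => k _; rewrite ltr_wpDr. Qed.

(** Dividing by [a * b] leaves the products of [a + k] and of [b + k] over [1 <= k < n]; strictness
    needs at least one factor, hence [1 < n]. *)
Lemma ltr_pochhammer a b n : 0 < a -> a < b -> (1 < n)%N ->
  b * pochhammer a n < a * pochhammer b n.
Proof.
move=> a0 ab; have b0 := lt_trans a0 ab.
case: n => [//|[//|n _]]; elim: n => [|n ih].
  rewrite !pochhammerS !pochhammer0 !mul1r !addr0.
  rewrite mulrA mulrA (mulrC b) ltr_pM2l ?mulr_gt0//.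
  by rewrite ltrD2r.
rewrite pochhammerS [pochhammer b _]pochhammerS !mulrA ltr_pM//.
- by rewrite mulr_ge0 ?ltW// pochhammer_gt0.
- by rewrite addr_ge0// ltW.
- by rewrite ltrD2r.
Qed.

(* [E(X^i (1 - X)^j)] for [X] of law Beta(a, b). *)
Definition beta_moment a b i j :=
  pochhammer a i * pochhammer b j / pochhammer (a + b) (i + j).

Lemma beta_momentD a b i j : 0 < a -> 0 < b ->
  beta_moment a b i.+1 j + beta_moment a b i j.+1 = beta_moment a b i j.
Proof.
move=> a0 b0; rewrite /beta_moment addSn addnS !pochhammerS natrD.
have s0 : pochhammer (a + b) (i + j) != 0.
  by rewrite gt_eqF// pochhammer_gt0// addr_gt0.
have t0 : a + b + (i%:R + j%:R) != 0.
  by rewrite -natrD gt_eqF// ltr_wpDr// addr_gt0.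
by field; rewrite s0.
Qed.

(** For [a = p al] and [b = (1 - p) al] the ratio is [(1 - p) * (al / (al + n))], so the Beta
    moments obey the relation imposed on [e n 1]. *)
Lemma beta_moment_S1 a b n : 0 < a -> 0 < b ->
  beta_moment a b n 1 = b / (a + b + n%:R) * beta_moment a b n 0.
Proof.
move=> a0 b0; rewrite /beta_moment addn1 addn0 !pochhammerS !pochhammer0 mul1r mulr1 addr0.
have s0 : pochhammer (a + b) n != 0 by rewrite gt_eqF// pochhammer_gt0// addr_gt0.
have t0 : a + b + n%:R != 0 by rewrite gt_eqF// ltr_wpDr// addr_gt0.
by field; rewrite s0.
Qed.

Lemma beta_momentC a b i j : beta_moment a b i j = beta_moment b a j i.
Proof. by rewrite /beta_moment addrC addnC (mulrC (pochhammer a i)). Qed.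

Lemma beta_moment_1 (al : R) n : 0 < al -> beta_moment 1 al 0 n = al / (al + n%:R).
Proof.
move=> al0; have aln0 k : al + k%:R != 0 by rewrite gt_eqF// ltr_wpDr.
have E : pochhammer al n * (al + n%:R) = al * pochhammer (1 + al) n.
  elim: n => [|n ih]; first by rewrite !pochhammer0 addr0 mulr1 mul1r.
  by rewrite !pochhammerS ih -natr1; ring.
have p0 : pochhammer (1 + al) n != 0 by rewrite gt_eqF// pochhammer_gt0// addr_gt0.
rewrite /beta_moment pochhammer0 mul1r add0n.
by apply/eqP; rewrite eqr_div// E.
Qed.

(* The defects [D i j := e i j - beta_moment i j] with [i + j = n + 1] alternate in sign along
   the antidiagonal as soon as they vanish on the previous one; comparing its two ends gives a
   linear equation for [c n] which is nondegenerate because [p <> 1 - p]. *)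
Lemma moments_rigid (p al : R) (e : nat -> nat -> R) (c : nat -> R) :
  0 < p < 1 -> p <> 1 / 2 -> 0 < al ->
  e 0%N 0%N = 1 -> (forall i j, e i.+1 j + e i j.+1 = e i j) ->
  (forall n, e n 1%N = (1 - p) * c n * e n 0%N) ->
  (forall n, e 1%N n = p * c n * e 0%N n) ->
  c 0%N = 1 -> c 1%N = al / (al + 1) ->
  (forall n, c n = al / (al + n%:R)) /\
  (forall i j, e i j = beta_moment (p * al) ((1 - p) * al) i j).
Proof.
move=> /andP[p0 p1] p12 al0 e00 eD en1 e1n c0 c1.
set a := p * al; set b := (1 - p) * al.
have q0 : 0 < 1 - p by rewrite subr_gt0.
have a0 : 0 < a by rewrite mulr_gt0.
have b0 : 0 < b by rewrite mulr_gt0.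
have abE : a + b = al by rewrite /a /b; ring.
have aln n : al + n%:R != 0 by rewrite gt_eqF// ltr_wpDr.
suff H n : (forall i j, (i + j <= n)%N -> e i j = beta_moment a b i j) /\
           (forall k, (k < n)%N -> c k = al / (al + k%:R)).
  by split=> [n|i j]; [exact: (H n.+1).2|exact: (H (i + j)%N).1].
elim: n => [|n [ihe ihc]].
  split=> // -[|//] [|//] _.
  by rewrite e00 /beta_moment !pochhammer0 mul1r divr1.
pose D i j := e i j - beta_moment a b i j.
have DS i j : (i + j = n)%N -> D i j.+1 = - D i.+1 j.
  move=> ij; have := eD i j; have := beta_momentD a b i j a0 b0.
  rewrite -(ihe i j) ?ij// /D => <- /eqP; rewrite -subr_eq0 => /eqP h.
  apply/eqP; rewrite -subr_eq0; apply/eqP; rewrite -[RHS]h; ring.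
have DE i j : (i + j = n.+1)%N -> D i j = (-1) ^+ j * D n.+1 0%N.
  elim: j i => [|j ih] i; first by rewrite addn0 => ->; rewrite mul1r.
  rewrite addnS => -[ij]; rewrite DS// ih ?addSn ?ij// exprS; ring.
(* The antidiagonal [i + j = n] is already known, so the entries next to both ends of the following
   one deviate from the Beta values only through the error in [c n]. *)
have Dn1 : D n 1%N = (1 - p) * (c n - al / (al + n%:R)) * beta_moment a b n 0.
  rewrite /D en1 beta_moment_S1// abE (ihe n 0%N) ?addn0// /b; field; exact: aln.
have D1n : D 1%N n = p * (c n - al / (al + n%:R)) * beta_moment a b 0 n.
  rewrite /D e1n (beta_momentC _ _ 1) beta_moment_S1// (addrC b) abE.
  rewrite -(beta_momentC a b 0) (ihe 0%N n)// /a; field; exact: aln.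
suff cn : c n = al / (al + n%:R).
  have D0 : D n.+1 0%N = 0.
    have := DE n 1%N; rewrite addn1 => /(_ erefl); rewrite Dn1 cn subrr mulr0 mul0r.
    by rewrite expr1 mulN1r => /eqP; rewrite eq_sym oppr_eq0 => /eqP.
  split=> [i j|k]; last by rewrite ltnS leq_eqVlt => /orP[/eqP->//|/ihc].
  rewrite leq_eqVlt => /orP[/eqP ij|]; last by rewrite ltnS => /ihe.
  by apply/eqP; rewrite -subr_eq0 -/(D i j) DE// D0 mulr0.
(* At [n = 1] the equation for [c n] is void: [pochhammer a 1 = a] makes its coefficient
   proportional to [b * a - a * b]. There [c 1] is an input; from [n = 2] on the coefficient is
   shown to be nonzero. *)
case: n ihe ihc {DS} DE Dn1 D1n => [|[|n]] ihe ihc DE Dn1 D1n.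
- by rewrite c0 addr0 divff// gt_eqF.
- by rewrite c1.
set m := n.+2 in ihe ihc DE Dn1 D1n *.
apply/eqP; rewrite -subr_eq0; apply/eqP; set x := c m - _ in Dn1 D1n *.
have DD : D m 1%N = (-1) ^+ m.+1 * D 1%N m.
  rewrite (DE m 1%N) ?addn1// (DE 1%N m) ?add1n// mulrA -exprD.
  by rewrite expr1 addSn exprS addnn -mul2n exprM sqrrN !expr1n mulr1.
have : x * ((1 - p) * beta_moment a b m 0 - (-1) ^+ m.+1 * (p * beta_moment a b 0 m)) = 0.
  by apply/eqP; rewrite mulrBr subr_eq0; apply/eqP; move: DD; rewrite Dn1 D1n => h;
     rewrite mulrCA mulrA h; ring.
move=> /eqP; rewrite mulf_eq0 => /orP[/eqP//|]; rewrite subr_eq0 => /eqP h.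
exfalso; have {h} : b * pochhammer a m = (-1) ^+ m.+1 * (a * pochhammer b m).
  move: h; rewrite /beta_moment !pochhammer0 addn0 add0n mulr1 mul1r => h.
  have s0 : pochhammer (a + b) m != 0 by rewrite gt_eqF// pochhammer_gt0// addr_gt0.
  apply: (mulIf (invr_neq0 s0)); rewrite /a /b.
  transitivity (al * ((1 - p) * (pochhammer a m / pochhammer (a + b) m))).
    by rewrite /a /b; ring.
  by rewrite h /a /b; ring.
have ba_gt0 : 0 < b * pochhammer a m by rewrite mulr_gt0// pochhammer_gt0.
have ab_gt0 : 0 < a * pochhammer b m by rewrite mulr_gt0// pochhammer_gt0.
(* With sign [-1] a positive number would equal a negative one. With sign [+1], [ltr_pochhammer]
   leaves only [a = b], that is [p = 1 - p]. *)
rewrite -signr_odd; case: (odd _); rewrite ?expr1 ?expr0 ?mulN1r ?mul1r => h.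
  by move: ba_gt0; rewrite h oppr_gt0 => /(lt_trans ab_gt0); rewrite ltxx.
have [ab|ba|ab] := ltgtP a b.
- by have := ltr_pochhammer _ _ _ a0 ab (isT : (1 < m)%N); rewrite h ltxx.
- by have := ltr_pochhammer _ _ _ b0 ba (isT : (1 < m)%N); rewrite h ltxx.
- apply: p12; move: ab; rewrite /a /b => /(mulIf (lt0r_neq0 al0)) pq; lra.
Qed.

End pochhammer.

(** * The Gamma and Beta integrals *)

Section affine.
Context {R : realType}.
Local Notation mu := (@lebesgue_measure R).

(** As a function of [A] the right-hand side is a scaled pushforward of [mu], so uniqueness of
    Lebesgue measure reduces the claim to intervals []a, b]]. *)
Lemma lebesgue_measure_affine (c d : R) (A : set (measurableTypeR R)) : 0 < c -> measurable A ->
  (mu A = c%:E * mu ((fun x : R => (c * x + d)%R) @^-1` A))%E.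
Proof.
move=> c0 mA.
have mphi : measurable_fun [set: measurableTypeR R]
    (fun x : measurableTypeR R => (c * x + d)%R : measurableTypeR R).
  by apply: measurable_funD => //; apply: measurable_funM.
pose phi : {mfun measurableTypeR R >-> measurableTypeR R} :=
  HB.pack (fun x : measurableTypeR R => (c * x + d)%R : measurableTypeR R)
    (isMeasurableFun.Build _ _ _ _ _ mphi).
have c0' : 0 <= c by exact: ltW.
unshelve epose (pf := pushforward mu phi : {measure set (measurableTypeR R) -> \bar R});
  first exact: mphi.
pose m := mscale (NngNum c0') pf.
suff : (mu A = m A)%E by [].
apply: lebesgue_measure_unique => // _ [[a b]] _ <-.
change (mu `]a, b]%classic = c%:E * mu ((fun x : R => (c * x + d)%R) @^-1` `]a, b]%classic))%E.
rewrite (_ : _ @^-1` _ = `](a - d) / c, (b - d) / c]%classic); last first.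
  apply/seteqP; split=> x /=; rewrite !in_itv/= ltr_pdivrMr// ler_pdivlMr//;
  by rewrite ltrBlDr lerBrDr (mulrC x).
rewrite !lebesgue_measure_itv/= !lte_fin ltr_pM2r ?invr_gt0// ltrD2r.
case: ifPn => _; last by rewrite mule0.
rewrite -!EFinD -EFinM; congr EFin; field; exact: lt0r_neq0.
Qed.

Lemma ge0_integral_affine (c d : R) (f : R -> \bar R) : 0 < c ->
  measurable_fun setT f -> (forall x, (0 <= f x)%E) ->
  (\int[mu]_x f x = c%:E * \int[mu]_x f (c * x + d)%R)%E.
Proof.
move=> c0 mf f0.
have mphi : measurable_fun [set: measurableTypeR R]
    (fun x : measurableTypeR R => (c * x + d)%R : measurableTypeR R).
  by apply: measurable_funD => //; apply: measurable_funM.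
pose phi : {mfun measurableTypeR R >-> measurableTypeR R} :=
  HB.pack (fun x : measurableTypeR R => (c * x + d)%R : measurableTypeR R)
    (isMeasurableFun.Build _ _ _ _ _ mphi).
have c0' : 0 <= c by exact: ltW.
unshelve epose (pf := pushforward mu phi : {measure set (measurableTypeR R) -> \bar R});
  first exact: mphi.
pose m := mscale (NngNum c0') pf.
transitivity (\int[m]_x f x)%E.
  by apply: eq_measure_integral => A mA _; exact/lebesgue_measure_affine.
rewrite /m ge0_integral_mscale//; congr (_ * _)%E.
by rewrite /pf ge0_integral_pushforward.
Qed.

End affine.

(** * Improper integrals of powers and of the exponential *)

Section powR_integral.
Context {R : realType}.
Local Notation mu := (@lebesgue_measure R).

(** For [a < 1] the integrand is unbounded near [0], so the fundamental theorem of calculus is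
    applied on [[s / (n + 2), s]] and monotone convergence moves the left end to [0]. *)
Lemma integral_powR (a s : R) : 0 < a -> 0 < s ->
  (\int[mu]_(t in `]0%R, s[) (a * t `^ (a - 1))%:E = (s `^ a)%:E)%E.
Proof.
move=> a0 s0.
(* The shift [n.+2] keeps the left end strictly below [s] already at [n = 0], as [continuous_FTC2]
   requires. *)
pose F (n : nat) := `[s / n.+2%:R, s]%classic : set R.
have Fpos n : 0 < s / n.+2%:R by rewrite divr_gt0.
have Fs n : s / n.+2%:R < s by rewrite ltr_pdivrMr// ltr_pMr// ltr1n.
have FU : \bigcup_n F n = `]0, s]%classic.
  apply/seteqP; split=> [x [n _]|x] /=; rewrite /F/= !in_itv/=.
    by move=> /andP[nx ->]; rewrite (lt_le_trans _ nx).
  move=> /andP[x0 xs]; have [n] := ltr_add_invr (divr_gt0 x0 s0).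
  rewrite add0r => nx; exists n => //=; rewrite in_itv/= xs andbT.
  move: nx; rewrite ltr_pdivlMr// mulrC => /ltW; apply: le_trans.
  by rewrite ler_pM2l// lef_pV2 ?posrE// ler_nat.
have mf D : measurable_fun D (fun t : R => (a * t `^ (a - 1))%:E).
  by apply/measurable_EFinP/measurable_funTS/measurable_funM.
rewrite (@integral_itv_bndo_bndc _ _ s) -?FU//.
have Fc := @ge0_nondecreasing_set_cvg_integral _ (measurableTypeR R) R F
   (fun t : R => (a * t `^ (a - 1))%:E) mu.
have F_nd : {homo F : n m / (n <= m)%N >-> (n <= m)%O}.
  move=> n m nm; apply/subsetPset => x; rewrite /F/= !in_itv/= => /andP[+ ->].
  rewrite andbT; apply: le_trans; rewrite ler_pM2l// lef_pV2 ?posrE// ler_nat.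
  by rewrite !ltnS.
have f_ge0 n x : F n x -> (0 <= (a * x `^ (a - 1))%:E)%E.
  by move=> _; rewrite lee_fin mulr_ge0 ?powR_ge0// ltW.
have /cvg_lim <-// := Fc F_nd (fun=> measurable_itv _) (fun=> mf _) f_ge0.
apply/cvg_lim => //.
rewrite (_ : (fun _ => _) = (fun n => (s `^ a - (s / n.+2%:R) `^ a)%:E)).
  apply/cvg_EFin; first exact: nearW.
  rewrite -[X in _ --> X]subr0; apply: cvgB; first exact: cvg_cst.
  have /cvg_at_rightP := powR_cvg0 a0; apply; split => [n|]; first exact: Fpos.
  rewrite -(mulr0 s); apply: cvgM; first exact: cvg_cst.
  rewrite (cvg_shiftS (fun n => n.+1%:R^-1 : R)); exact: cvg_harmonic.
apply/funext => n; rewrite EFinB.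
have sub x : x \in `[s / n.+2%:R, s] -> 0 < x.
  by rewrite in_itv/= => /andP[+ _]; exact: lt_le_trans.
have cF (b x : R) : 0 < x -> (fun y : R => y `^ b) @ x --> x `^ b.
  move=> x0; have : derivable (fun y : R => y `^ b) x 1.
    by apply: derivable_powR; rewrite in_itv/= x0.
  by move=> /derivable1_diffP/differentiable_continuous.
have := @continuous_FTC2 R (fun t => a * t `^ (a - 1)) (fun t => t `^ a) _ _ (Fs n).
apply.
- apply: continuous_in_subspaceT => x /set_mem/sub x0.
  by apply: cvgM; [exact: cvg_cst|exact: cF].
- split => [x xI||].
  + by apply: derivable_powR; rewrite in_itv/= (sub x)//; apply: subset_itv_oo_cc xI.
  + exact/cvg_at_right_filter/cF/Fpos.
  + exact/cvg_at_left_filter/cF.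
- move=> x xI; rewrite powR_derive1// in_itv/= andbT.
  by apply: sub; apply: subset_itv_oo_cc xI.
Qed.

Lemma integral_expRN (t : R) :
  (\int[mu]_(s in `]t, +oo[) (expR (- s))%:E = (expR (- t))%:E)%E.
Proof.
rewrite integral_itv_obnd_cbnd//; last first.
  by apply/measurable_EFinP/measurable_funTS; apply: measurableT_comp.
have dN (x : R) : is_derive x (1 : R) (fun s : R => - expR (- s)) (expR (- x)).
  apply: is_derive_eq.
  by rewrite /GRing.scale/= mulrN1 opprK.
rewrite (@ge0_continuous_FTC2y _ _ (fun s : R => - expR (- s)) t 0).
- by rewrite EFinN oppeK add0e.
- by move=> x _; exact: expR_ge0.
- apply: continuous_subspaceT => x.
  by apply: (@continuous_comp _ _ _ -%R expR); [exact: opp_continuous|exact: continuous_expR].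
- by rewrite -oppr0; apply: cvgN; exact: cvgr_expR.
- by move=> x _; have [] := dN x.
- apply: cvg_at_right_filter; have [+ _] := dN t.
  by move=> /derivable1_diffP/differentiable_continuous.
- by move=> x _; rewrite derive1E; apply: derive_val.
Qed.

End powR_integral.

(** * Finiteness and positivity of Gamma, and its relation with the Beta integral *)

Section gamma_beta.
Context {R : realType}.
Local Notation mu := (@lebesgue_measure R).
Implicit Types a b : R.

Lemma patch_itvE (i : interval R) (f : R -> \bar R) (x : R) :
  (f \_ [set` i]) x = if x \in i then f x else 0%E.
Proof.
by rewrite patchE; congr (if _ then _ else _); apply/idP/idP; rewrite inE.
Qed.

(** The Gamma integrand is extended by [0] to the whole line, so that Tonelli and affine
    substitutions carry no domain. *)
Definition gamma_fun (a t : R) : R := if 0 < t then t `^ (a - 1) * expR (- t) else 0.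

(** [Gamma] is the [fine] of this value; the recurrence is proved in the extended reals because
    finiteness is deduced from it. *)
Definition eGamma (a : R) : \bar R :=
  (\int[mu]_(t in `]0%R, +oo[) (t `^ (a - 1) * expR (- t))%:E)%E.

Definition eBeta (a b : R) : \bar R :=
  (\int[mu]_(x in `[0%R, 1%R]) (x `^ (a - 1) * (1 - x) `^ (b - 1))%:E)%E.

Lemma eGamma_ge0 a : (0 <= eGamma a)%E.
Proof.
by apply: integral_ge0 => x _; rewrite lee_fin mulr_ge0 ?powR_ge0 ?expR_ge0.
Qed.

Lemma measurable_gamma a : measurable_fun setT (gamma_fun a).
Proof.
apply: measurable_fun_if => //.
- exact: measurable_fun_ltr.
- apply/measurable_funTS/measurable_funM => //.
  by apply: measurableT_comp.
Qed.

Lemma measurable_egamma a :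
  measurable_fun [set: measurableTypeR R] (fun x : measurableTypeR R => (gamma_fun a x)%:E).
Proof.
have H : measurable_fun [set: R] (EFin \o gamma_fun a).
  by apply/measurable_EFinP; exact: measurable_gamma.
exact: H.
Qed.

Lemma gamma_ge0 a t : 0 <= gamma_fun a t.
Proof.
by rewrite /gamma_fun; case: ifP => // _; rewrite mulr_ge0 ?powR_ge0 ?expR_ge0.
Qed.

Lemma eGammaE a : (eGamma a = \int[mu]_t (gamma_fun a t)%:E)%E.
Proof.
rewrite /eGamma integral_mkcond; apply: eq_integral => t _.
by rewrite patch_itvE in_itv/= andbT /gamma_fun; case: ifP.
Qed.

(* Tonelli on [{(t, s) | 0 < t < s}]: both sides of the recurrence are the integral of
   [a t^(a-1) e^(-s)] *)
Lemma eGammaS a : 0 < a -> (eGamma (a + 1) = a%:E * eGamma a)%E.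
Proof.
move=> a0.
pose h (z : measurableTypeR R * measurableTypeR R) : R :=
  if (0 < z.1) && (z.1 < z.2) then a * z.1 `^ (a - 1) * expR (- z.2) else 0.
have h0 z : (0 <= (h z)%:E)%E.
  rewrite lee_fin /h; case: ifP => // _.
  by rewrite !mulr_ge0 ?powR_ge0 ?expR_ge0// ltW.
have mh : measurable_fun setT (EFin \o h).
  apply/measurable_EFinP; apply: measurable_fun_if => //.
  - apply: measurable_and.
      by apply: measurable_fun_ltr.
    by apply: measurable_fun_ltr.
  - apply/measurable_funTS/measurable_funM.
      apply: measurable_funM => //.
      by apply: (@measurableT_comp _ _ _ _ _ _ (fun x : R => x `^ (a - 1))).
    apply: measurableT_comp => //.
    by apply: measurableT_comp.
have := fubini_tonelli (m1 := mu) (m2 := mu) (EFin \o h) mh h0.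
rewrite (_ : (\int[mu]_x _)%E = a%:E * eGamma a)%E; last first.
  rewrite eGammaE -ge0_integralZl//; last 3 first.
    exact: measurable_egamma.
    by move=> x _; rewrite lee_fin gamma_ge0.
    by rewrite lee_fin ltW.
  apply: eq_integral => t _; rewrite /h/=.
  transitivity (\int[mu]_(s in `]t, +oo[)
     ((if (0 < t)%R then (a * t `^ (a - 1))%R else 0%R)%:E * (expR (- s))%:E))%E.
    rewrite [RHS]integral_mkcond; apply: eq_integral => s _.
    rewrite patch_itvE in_itv/= andbT -EFinM.
    by case: (0 < t); case: (t < s); rewrite //= mul0r.
  rewrite ge0_integralZl//.
  - rewrite integral_expRN /gamma_fun; case: ifP => _; last by rewrite mul0e mule0.
    by rewrite -!EFinM mulrA.
  - by apply/measurable_EFinP/measurable_funTS; apply: measurableT_comp.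
  - by rewrite lee_fin; case: ifP => // _; rewrite mulr_ge0 ?powR_ge0// ltW.
move=> ->; rewrite eGammaE; apply: eq_integral => s _; rewrite /h/= /gamma_fun.
have [s0|s0] := ltP 0 s; last first.
  apply/esym; apply: integral0_eq => t _; case: ifP => // /andP[t0 ts].
  by have := lt_le_trans (lt_trans t0 ts) s0; rewrite ltxx.
transitivity (\int[mu]_(t in `]0%R, s[) ((expR (- s))%:E * (a * t `^ (a - 1))%:E))%E.
  rewrite ge0_integralZl//.
  - by rewrite integral_powR// -EFinM mulrC addrK.
  - by apply/measurable_EFinP/measurable_funTS; apply: measurable_funM.
  - by move=> x _; rewrite lee_fin mulr_ge0 ?powR_ge0// ltW.
rewrite [LHS]integral_mkcond; apply: eq_integral => t _.
by rewrite patch_itvE in_itv/=; case: (0 < t); case: (t < s); rewrite //= -EFinM mulrC.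
Qed.

Lemma eGamma1 : eGamma 1 = 1%E.
Proof.
rewrite /eGamma -[RHS](_ : (expR (- 0))%:E = _); last by rewrite oppr0 expR0.
rewrite -integral_expRN; apply: eq_integral => x _.
by rewrite subrr powRr0 mul1r.
Qed.

(** For [0 < b <= 1] the recurrence gives [b Gamma(b) = Gamma(b + 1)], and [x^b <= 1 + x] bounds
    this by [Gamma(1) + Gamma(2)], so the singularity at [0] is never estimated. Larger arguments
    descend to this case by the recurrence. *)
Lemma eGamma_lty a : 0 < a -> (eGamma a < +oo)%E.
Proof.
have le1 b : 0 < b -> b <= 1 -> (eGamma b < +oo)%E.
  move=> b0 b1.
  suff : (b%:E * eGamma b < +oo)%E.
    have := eGamma_ge0 b; case: (eGamma b) => [r||]// _; rewrite ?ltry//.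
    by rewrite gt0_muley ?lte_fin.
  rewrite -eGammaS//; apply: (@le_lt_trans _ _ (eGamma 1 + eGamma 2)%E); last first.
    by rewrite (_ : 2 = 1 + 1 :> R)// eGammaS// eGamma1 mule1 -EFinD ltry.
  rewrite !eGammaE -ge0_integralD//; last 4 first.
    by move=> x _; rewrite lee_fin gamma_ge0.
    exact: measurable_egamma.
    by move=> x _; rewrite lee_fin gamma_ge0.
    exact: measurable_egamma.
  apply: ge0_le_integral => //.
  - by move=> x _; rewrite lee_fin gamma_ge0.
  - exact: measurable_egamma.
  - by apply/measurable_EFinP/measurable_funD; exact: measurable_gamma.
  move=> x _; rewrite -EFinD lee_fin /gamma_fun; case: ifP => x0; last by rewrite addr0.
  rewrite -mulrDl ler_pM2r ?expR_gt0// addrK subrr powRr0.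
  have x0' := ltW x0.
  rewrite (_ : 2 - 1 = 1 :> R) ?powRr1//; last by lra.
  have [x1|x1] := leP x 1.
    apply: (@le_trans _ _ (1 `^ b)); last by rewrite powR1 lerDl.
    by apply: ge0_ler_powR; rewrite ?nnegrE// ltW.
  by rewrite ler_wpDl// ler1_powR// ltW.
move=> a0; have [n] : exists n : nat, a <= n.+1%:R.
  by exists (Num.trunc a); exact/ltW/truncnS_gt.
elim: n a a0 => [|n ih] a a0 an; first exact: le1.
have [a1|a1] := leP a 1; first exact: le1.
rewrite -(subrK 1 a) eGammaS ?subr_gt0//.
have a10 : 0 < a - 1 by rewrite subr_gt0.
have : a - 1 <= n.+1%:R by rewrite lerBlDr natr1.
move=> /(ih _ a10).
have := eGamma_ge0 (a - 1); case: (eGamma (a - 1)) => [r||]// _ _.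
by rewrite -EFinM ltry.
Qed.

Lemma eGamma_gt0 a : 0 < a -> (0 < eGamma a)%E.
Proof.
(* On []0, 1[] one has [e^(-t) >= e^(-1)], whence the lower bound [e^(-1) / a]. *)
move=> a0; apply: (@lt_le_trans _ _ ((expR (- 1) / a)%:E * (1 `^ a)%:E)%E).
  by rewrite powR1 mule1 lte_fin divr_gt0// expR_gt0.
rewrite -(@integral_powR R a 1 a0)// -ge0_integralZl//; last 3 first.
- by apply/measurable_EFinP/measurable_funTS; apply: measurable_funM.
- by move=> x _; rewrite lee_fin mulr_ge0 ?powR_ge0// ltW.
- by rewrite lee_fin divr_ge0 ?expR_ge0// ltW.
have mg D : measurable_fun D (fun t : measurableTypeR R => (t `^ (a - 1) * expR (- t))%:E).
  apply/measurable_EFinP/measurable_funTS; apply: measurable_funM => //.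
  by apply: measurableT_comp.
have sub : (`]0%R, 1%R[%classic : set R) `<=` `]0%R, +oo[%classic.
  by move=> x /=; rewrite !in_itv/= andbT => /andP[].
apply: (@le_trans _ _
    (\int[mu]_(t in `]0%R, 1%R[) (t `^ (a - 1) * expR (- t))%:E)%E); last first.
  apply: ge0_subset_integral => //.
  by move=> x _; rewrite lee_fin mulr_ge0 ?powR_ge0 ?expR_ge0.
apply: ge0_le_integral => //.
- by move=> x _; rewrite -EFinM lee_fin mulr_ge0 ?divr_ge0 ?mulr_ge0 ?powR_ge0 ?expR_ge0// ltW.
- by apply: measurable_funeM; apply/measurable_EFinP/measurable_funTS; apply: measurable_funM.
move=> x /=; rewrite in_itv/= => /andP[x0 x1].
rewrite -EFinM lee_fin mulrA divfK ?gt_eqF// mulrC ler_wpM2l ?powR_ge0// ler_expR.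
by rewrite lerN2 ltW.
Qed.

Lemma measurable_beta a b : measurable_fun [set: measurableTypeR R]
  (fun x : measurableTypeR R => (x `^ (a - 1) * (1 - x) `^ (b - 1))%:E).
Proof.
apply/measurable_EFinP; apply: measurable_funM => //.
apply: (@measurableT_comp _ _ _ _ _ _ (fun x : R => x `^ (b - 1))) => //.
exact: measurable_funB.
Qed.

(* Tonelli for [s^(a-1) t^(b-1) e^(-s-t)] in the variables [s] and [r = s + t], then [s = r x]. *)
Lemma eGamma_eBeta a b : 0 < a -> 0 < b ->
  (eGamma a * eGamma b = eGamma (a + b) * eBeta a b)%E.
Proof.
move=> a0 b0.
pose h (z : measurableTypeR R * measurableTypeR R) : R :=
  gamma_fun a z.1 * gamma_fun b (z.2 - z.1).
have h0 z : (0 <= (h z)%:E)%E by rewrite lee_fin /h mulr_ge0 ?gamma_ge0.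
have mh : measurable_fun setT (EFin \o h).
  apply/measurable_EFinP; apply: measurable_funM.
    by apply: measurableT_comp; [exact: measurable_gamma|exact: measurable_fst].
  apply: measurableT_comp; first exact: measurable_gamma.
  by apply: measurable_funB.
have := fubini_tonelli (m1 := mu) (m2 := mu) (EFin \o h) mh h0.
rewrite (_ : (\int[mu]_x _)%E = eGamma a * eGamma b)%E; last first.
  rewrite [X in (X * _)%E]eGammaE muleC -ge0_integralZl ?eGamma_ge0//; last 2 first.
    exact: measurable_egamma.
    by move=> x _; rewrite lee_fin gamma_ge0.
  apply: eq_integral => s _; rewrite /h/=.
  under eq_integral do rewrite EFinM.
  rewrite ge0_integralZl//; last 3 first.
  - apply/measurable_EFinP/measurableT_comp; first exact: measurable_gamma.
    exact: measurable_funB.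
  - by move=> x _; rewrite lee_fin gamma_ge0.
  - by rewrite lee_fin gamma_ge0.
  rewrite muleC; congr (_ * _)%E; rewrite eGammaE.
  rewrite (@ge0_integral_affine _ 1 (- s))//.
  - by rewrite mul1e; under [RHS]eq_integral do rewrite mul1r.
  - exact: measurable_egamma.
  - by move=> x; rewrite lee_fin gamma_ge0.
move=> ->; rewrite [X in (X * _)%E]eGammaE muleC -ge0_integralZl//; last 3 first.
- exact: measurable_egamma.
- by move=> x _; rewrite lee_fin gamma_ge0.
- apply: integral_ge0 => x _.
  by rewrite lee_fin mulr_ge0 ?powR_ge0.
apply: eq_integral => r _; rewrite /h/=.
have [r0|r0] := ltP 0 r; last first.
  rewrite [gamma_fun (a + b) r]/gamma_fun ltNge r0 /= mule0.
  apply: integral0_eq => s _; rewrite /gamma_fun subr_gt0.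
  case: ifP => s0; last by rewrite mul0r.
  by case: ifP => sr; [have := lt_le_trans (lt_trans s0 sr) r0; rewrite ltxx|rewrite mulr0].
rewrite (@ge0_integral_affine _ r 0)//; last 2 first.
- apply/measurable_EFinP/measurable_funM; first exact: measurable_gamma.
  apply: measurableT_comp; first exact: measurable_gamma.
  exact: measurable_funB.
- by move=> x; rewrite lee_fin mulr_ge0 ?gamma_ge0.
(* The functions [gamma_fun] vanish at [x = 0] and [x = 1], while [powR] has value [1] at base and
   exponent [0]; the integrands agree after removal of the two endpoints. *)
rewrite /eBeta (@integral_itv_bndoo _ _ _ _ true false); last first.
  by apply: measurable_funTS; exact: measurable_beta.
rewrite [RHS]muleC.
rewrite -ge0_integralZl_EFin//; last 3 first.
- by move=> x _; rewrite lee_fin mulr_ge0 ?gamma_ge0.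
- apply/measurable_EFinP/measurable_funM.
    apply: (@measurableT_comp _ _ _ _ _ _ (gamma_fun a)); first exact: measurable_gamma.
    by apply: measurable_funD => //; apply: measurable_funM.
  apply: (@measurableT_comp _ _ _ _ _ _ (gamma_fun b)); first exact: measurable_gamma.
  apply: measurable_funB => //.
  by apply: measurable_funD => //; apply: measurable_funM.
- by rewrite ltW.
rewrite -ge0_integralZl_EFin//; last 3 first.
- by move=> x _; rewrite lee_fin mulr_ge0 ?powR_ge0.
- by apply: measurable_funTS; exact: measurable_beta.
- by rewrite gamma_ge0.
rewrite [RHS]integral_mkcond; apply: eq_integral => x _.
rewrite patch_itvE in_itv/= addr0 /gamma_fun pmulr_rgt0// r0 subr_gt0 gtr_pMr//.
case: (ltP 0 x) => x0; last by rewrite mul0r mule0.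
case: (ltP x 1) => x1; last by rewrite mulr0 mule0.
rewrite -!EFinM; congr EFin.
(* The isolated factor [r] is the Jacobian of [s = r x]. *)
have -> : r `^ (a + b - 1) = r * r `^ (a - 1) * r `^ (b - 1).
  rewrite -{2}(powRr1 (ltW r0)) -!powRD ?(gt_eqF r0) ?implybT//.
  by congr (_ `^ _); ring.
have -> : expR (- r) = expR (- (r * x)) * expR (- (r - r * x)).
  by rewrite -expRD; congr expR; ring.
have -> : r - r * x = r * (1 - x) by ring.
by rewrite !powRM ?subr_ge0 ?ltW//; ring.
Qed.

End gamma_beta.

(** * Moment determinacy on the unit interval *)

Section weighted_law.
Context {d} {T : measurableType d} {R : realType} (m : {measure set T -> \bar R}).

Import HBNNSimple.

(** The integral formula is checked on simple functions and passes to [f] by monotone convergence on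
    both sides. *)
Lemma density_measure_ex (h : T -> R) :
  measurable_fun setT h -> (forall x, 0 <= h x) ->
  exists nu : {measure set T -> \bar R}, forall f : T -> \bar R,
    measurable_fun setT f -> (forall x, (0 <= f x)%E) ->
    (\int[nu]_x f x = \int[m]_x ((h x)%:E * f x))%E.
Proof.
move=> mh h0.
have mhE : measurable_fun setT (EFin \o h) by exact/measurable_EFinP.
have h0E x : (0 <= (EFin \o h) x)%E by rewrite lee_fin.
pose nu0 (A : set T) := (\int[m]_(x in A) (h x)%:E)%E.
have nu00 : nu0 set0 = 0%E by rewrite /nu0 integral_set0.
have nu0_ge0 A : (0 <= nu0 A)%E by apply: integral_ge0 => x _; exact: h0E.
have nu0_sig : semi_sigma_additive nu0 by exact: semi_sigma_additive_nng_induced.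
pose nu : {measure set T -> \bar R} :=
  HB.pack nu0 (isMeasure.Build _ _ _ nu0 nu00 nu0_ge0 nu0_sig).
exists nu => f mf f0.
pose g := nnsfun_approx measurableT mf.
have gf x : (EFin \o g n) x @[n --> \oo] --> f x by apply: cvg_nnsfun_approx.
have nd_g x : {homo (fun n => (g n x)%:E) : a b / (a <= b)%N >-> (a <= b)%E}.
  by move=> a b ab; rewrite lee_fin; exact/lefP/nd_nnsfun_approx.
have -> : (\int[nu]_x f x = lim (\int[nu]_x (g n x)%:E @[n --> \oo]))%E.
  have mg n : measurable_fun setT (fun x => (g n x)%:E) by exact/measurable_EFinP.
  have g0 n x : setT x -> (0 <= (g n x)%:E)%E by rewrite lee_fin.
  rewrite -(monotone_convergence nu measurableT mg g0 (fun x _ => @nd_g x)).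
  by apply: eq_integral => x _; apply/esym/cvg_lim => //; exact: gf.
have -> : (\int[m]_x ((h x)%:E * f x) =
    lim (\int[m]_x ((h x)%:E * (g n x)%:E) @[n --> \oo]))%E.
  have mg n : measurable_fun setT (fun x => (h x)%:E * (g n x)%:E)%E.
    by apply: emeasurable_funM => //; exact/measurable_EFinP.
  have g0 n x : setT x -> (0 <= (h x)%:E * (g n x)%:E)%E.
    by rewrite mule_ge0 ?lee_fin.
  have nd_hg x : setT x ->
      {homo (fun n => (h x)%:E * (g n x)%:E)%E : a b / (a <= b)%N >-> (a <= b)%E}.
    by move=> _ a b ab; rewrite lee_wpmul2l ?lee_fin// -lee_fin; exact: nd_g.
  rewrite -(monotone_convergence m measurableT mg g0 nd_hg).
  by apply: eq_integral => x _; apply/esym/cvg_lim => //; apply: cvgeZl => //; exact: gf.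
suff suf n : (\int[m]_x ((h x)%:E * (g n x)%:E) = \int[nu]_x (g n x)%:E)%E.
  by under [in RHS]eq_fun do rewrite suf.
under [RHS]eq_integral do rewrite fimfunE -fsumEFin//.
rewrite ge0_integral_fsum//; last 2 first.
- by move=> r; exact/measurable_EFinP/measurable_funM.
- by move=> r x _; rewrite nnfun_muleindic_ge0.
under eq_integral => x _.
  rewrite fimfunE -fsumEFin// ge0_mule_fsumr; last first.
    by move=> r; rewrite nnfun_muleindic_ge0.
  over.
rewrite ge0_integral_fsum//; last 2 first.
- by move=> r; apply: emeasurable_funM => //; exact/measurable_EFinP/measurable_funM.
- by move=> r x _; apply: mule_ge0; [rewrite lee_fin|exact: nnfun_muleindic_ge0].
apply: eq_fsbigr => r rg; rewrite integralZl_indic_nnsfun//.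
have r0 : 0 <= r by move: rg; rewrite inE => -[x _ <-].
have -> : (\int[nu]_x (\1_(g n @^-1` [set r]) x)%:E = nu0 (g n @^-1` [set r]))%E.
  by rewrite integral_indic// setIT.
under eq_integral do rewrite EFinM muleCA.
rewrite ge0_integralZl//; last 2 first.
- by apply: emeasurable_funM => //; exact/measurable_EFinP.
- by move=> x _; rewrite mule_ge0 ?lee_fin.
congr (_ * _)%E; rewrite /nu0 [RHS]integral_mkcond; apply: eq_integral => x _.
by rewrite epatch_indic.
Qed.

(** This turns an expectation [E(h g(X))] into an integral of [g] against a measure on the line, the
    setting of moment determinacy. *)
Lemma weighted_law_ex (h X : T -> R) :
  measurable_fun setT h -> (forall x, 0 <= h x) -> measurable_fun setT X ->
  exists nu : {measure set R -> \bar R}, forall g : R -> \bar R,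
    measurable_fun setT g -> (forall y, (0 <= g y)%E) ->
    (\int[nu]_y g y = \int[m]_x ((h x)%:E * g (X x)))%E.
Proof.
move=> mh h0 mX; have [nu nuE] := density_measure_ex h mh h0.
unshelve epose (pf := pushforward nu X : {measure set R -> \bar R}); first exact: mX.
exists pf => g mg g0; rewrite /pf ge0_integral_pushforward// preimage_setT nuE//.
  exact: measurableT_comp.
by move=> x; exact: g0.
Qed.

End weighted_law.

(** * Polynomial approximation of step functions *)

Section step_approximation.
Context {R : realType}.

Lemma bernoulli_ineq (y : R) n : -1 <= y -> 1 + n%:R * y <= (1 + y) ^+ n.
Proof.
move=> y1; elim: n => [|n ih]; first by rewrite mul0r addr0.
rewrite exprS; apply: (@le_trans _ _ ((1 + y) * (1 + n%:R * y))); last first.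
  by rewrite ler_wpM2l//; lra.
have : 0 <= n%:R * (y * y) by rewrite mulr_ge0// -expr2 sqr_ge0.
rewrite -natr1; lra.
Qed.

(** With [s = (1 + q) / 2 < 1] one has [q <= s^2]. Bernoulli for [s^-1 = 1 + d] bounds [n s^n] by
    [1 / d], so [n q^n <= s^n / d]. *)
Lemma cvg_natM_expr (q : R) : 0 <= q < 1 -> (n%:R * q ^+ n) @[n --> \oo] --> 0.
Proof.
move=> /andP[q0 q1]; pose s := (1 + q) / 2.
have s0 : 0 < s by rewrite /s; lra.
have s0' := ltW s0.
have s1 : s < 1 by rewrite /s; lra.
have qs : q <= s * s.
  have : 0 <= ((1 - q) / 2) ^+ 2 by exact: sqr_ge0.
  rewrite /s expr2; lra.
pose d := s^-1 - 1.
have d0 : 0 < d by rewrite subr_gt0 invf_gt1.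
have sn_cvg : (d^-1 * s ^+ n) @[n --> \oo] --> 0.
  rewrite -(mulr0 d^-1); apply: cvgM; first exact: cvg_cst.
  by apply: cvg_expr; rewrite ger0_norm// ltW.
apply: (squeeze_cvgr _ (cvg_cst 0) sn_cvg); apply: nearW => n.
rewrite mulr_ge0 ?exprn_ge0//=.
apply: (@le_trans _ _ (n%:R * (s * s) ^+ n)).
  by rewrite ler_wpM2l// lerXn2r ?nnegrE// ltW// mulr_gt0.
rewrite exprMn mulrA ler_wpM2r ?exprn_ge0//.
rewrite -(ler_pM2l d0) mulfV ?gt_eqF// mulrCA mulrA.
have key : n%:R * d <= s^-1 ^+ n.
  apply: le_trans (_ : (1 + d) ^+ n <= _).
    apply: le_trans (bernoulli_ineq d n _); first by rewrite lerDr.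
    by rewrite (le_trans _ (ltW d0))// lerN10.
  by rewrite /d addrCA subrr addr0.
apply: (le_trans (ler_wpM2r (exprn_ge0 n s0') key)).
by rewrite -exprMn mulVf ?gt_eqF// expr1n.
Qed.

(* Polynomials converging pointwise on [0, 1] to the indicator of [{x | x < 1/r}], also at
   [x = 1/r] because of the factor [n] in the exponent: by Bernoulli,
   [1 - N x^n <= (1 - x^n)^N <= 1 / (1 + N x^n)] where [N] is about [n r^n]. *)
Lemma cvg_step_approximation (r x : R) : 1 <= r -> 0 <= x <= 1 ->
  (1 - x ^+ n) ^+ (Num.trunc (n%:R * r ^+ n)).+1 @[n --> \oo] --> ((x * r < 1)%R%:R : R).
Proof.
move=> r1 /andP[x0 x1]; have r0 : 0 < r by exact: lt_le_trans r1.
have xn1 n : 0 <= 1 - x ^+ n <= 1.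
  by rewrite subr_ge0 exprn_ile1// gerBl exprn_ge0.
have rn0 n : 0 <= n%:R * r ^+ n by rewrite mulr_ge0 ?exprn_ge0// ltW.
have [xr|xr] := ltP (x * r) 1.
- have x1' : x < 1 by rewrite (le_lt_trans _ xr)// ler_peMr.
  (* This is Bernoulli's lower bound [1 - N x^n] after [N <= n r^n + 1]. *)
  have lcvg : (1 - (n%:R * (x * r) ^+ n + x ^+ n)) @[n --> \oo] --> (1 : R).
    rewrite -[X in _ --> X]subr0; apply: cvgB; first exact: cvg_cst.
    rewrite -[X in _ --> X]addr0; apply: cvgD.
      by apply: cvg_natM_expr; rewrite mulr_ge0//= ltW.
    by apply: cvg_expr; rewrite ger0_norm.
  rewrite /= mulr1n; apply: (squeeze_cvgr _ lcvg (cvg_cst (1 : R))); apply: nearW => n.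
  rewrite exprn_ile1//=; [|by case/andP: (xn1 n)..]; rewrite andbT.
  apply: le_trans (bernoulli_ineq (- x ^+ n) _ _); last by rewrite lerN2 exprn_ile1.
  rewrite mulrN lerD2l lerN2.
  have -> : n%:R * (x * r) ^+ n + x ^+ n = (n%:R * r ^+ n + 1) * x ^+ n.
    by rewrite exprMn; ring.
  rewrite ler_wpM2r ?exprn_ge0// -natr1 lerD2r.
  by have /andP[] := truncn_itv (rn0 n).
- have hcvg : harmonic n @[n --> \oo] --> (0 : R) by exact: cvg_harmonic.
  rewrite /= mulr0n; apply: (squeeze_cvgr _ (cvg_cst (0 : R)) hcvg); apply: nearW => n.
  have /andP[xn0 xn1'] := xn1 n.
  rewrite exprn_ge0//=; set N := (Num.trunc _).+1.
  (* From [x r >= 1] and [N > n r^n] it follows that [N x^n >= n], so the upper bound becomes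
     [1 / (n + 1)]. *)
  have NX : n%:R <= N%:R * x ^+ n.
    apply: (@le_trans _ _ (n%:R * r ^+ n * x ^+ n)).
      by rewrite -mulrA -exprMn (mulrC r) ler_peMr// exprn_ege1.
    by rewrite ler_wpM2r ?exprn_ge0// ltW// truncnS_gt.
  (* Bernoulli is applied to [(1 + x^n)^N], and [(1 - x^n) (1 + x^n) <= 1]. *)
  have : (1 - x ^+ n) ^+ N * (1 + N%:R * x ^+ n) <= 1.
    apply: (@le_trans _ _ ((1 - x ^+ n) ^+ N * (1 + x ^+ n) ^+ N)).
      rewrite ler_wpM2l ?exprn_ge0//; apply: bernoulli_ineq.
      by rewrite (le_trans _ (exprn_ge0 n x0))// lerN10.
    have xn := exprn_ge0 n x0; rewrite -exprMn; apply: exprn_ile1.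
      by apply: mulr_ge0 => //; exact: addr_ge0.
    by have := sqr_ge0 (x ^+ n); rewrite expr2; lra.
  move=> h; rewrite /harmonic -(@ler_pM2r _ n.+1%:R)// mulVf//.
  apply: le_trans h; rewrite ler_wpM2l ?exprn_ge0//.
  by rewrite -natr1 addrC lerD2l.
Qed.

End step_approximation.

(** * Measures with equal moments on the unit interval *)

Section moment_determinacy.
Context {R : realType}.
Implicit Types mu nu : {measure set R -> \bar R}.

Lemma integrable_expr01 mu n : (mu `[0%R, 1%R]%classic < +oo)%E ->
  mu.-integrable `[0%R, 1%R] (fun x : R => (x ^+ n)%:E).
Proof.
move=> mu_fin; apply: (@measurable_bounded_integrable _ _ _ mu (fun x : R => x ^+ n)) => //.
exists 1; split; first exact: num_real.
move=> M M1 x /=; rewrite in_itv/= => /andP[x0 x1].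
by rewrite ger0_norm ?exprn_ge0// (le_trans _ (ltW M1))// exprn_ile1.
Qed.

(** By the binomial expansion, the integrals of the step approximations depend on [mu] through its
    moments alone. *)
Lemma integral_onemXX mu n N : (mu `[0%R, 1%R]%classic < +oo)%E ->
  (\int[mu]_(x in `[0%R, 1%R]) ((1 - x ^+ n) ^+ N)%:E =
   \sum_(i < N.+1) ((-1) ^+ i *+ 'C(N, i))%:E *
      \int[mu]_(x in `[0%R, 1%R]) (x ^+ (n * i))%:E)%E.
Proof.
move=> mu_fin.
transitivity (\int[mu]_(x in `[0%R, 1%R])
   \sum_(i < N.+1) (((-1) ^+ i *+ 'C(N, i))%:E * (x ^+ (n * i))%:E))%E.
  apply: eq_integral => x _; rewrite exprBn -sumEFin; apply: eq_bigr => i _.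
  by rewrite -EFinM expr1n mulr1 -exprM mulrnAl.
rewrite integral_sum//; last first.
  by move=> i; apply: integrableZl => //; exact: integrable_expr01.
apply: eq_bigr => i _; rewrite integralZl//; exact: integrable_expr01.
Qed.

Lemma cvg_integral_step mu (r : R) : (mu `[0%R, 1%R]%classic < +oo)%E -> 1 <= r ->
  (\int[mu]_(x in `[0%R, 1%R]) ((1 - x ^+ n) ^+ (Num.trunc (n%:R * r ^+ n)).+1)%:E)%E
    @[n --> \oo] --> mu (`]-oo, r^-1[ `&` `[0%R, 1%R]).
Proof.
move=> mu_fin r1; have r0 : 0 < r by exact: lt_le_trans r1.
have -> : mu (`]-oo, r^-1[ `&` `[0%R, 1%R]) =
    (\int[mu]_(x in `[0%R, 1%R]) (\1_(`]-oo, r^-1[) x)%:E)%E.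
  by rewrite integral_indic.
have [] // := @dominated_convergence _ _ _ mu `[0%R, 1%R]%classic _
  (fun n x => ((1 - x ^+ n) ^+ (Num.trunc (n%:R * r ^+ n)).+1)%:E)
  (fun x => (\1_(`]-oo, r^-1[) x)%:E) (cst 1%E).
- move=> n; apply/measurable_EFinP; apply: measurable_funX.
  by apply: measurable_funB => //; exact: measurable_funX.
- by apply/measurable_EFinP.
- apply: aeW => x /=; rewrite in_itv/= => x01; apply: cvg_EFin; first exact: nearW.
  rewrite indicE (_ : (x \in _) = (x * r < 1)%R); first exact: cvg_step_approximation.
  by rewrite -(ltr_pdivlMr _ _ r0) mul1r; apply/idP/idP; rewrite inE/= in_itv.
- by apply: eq_integrable (integrable_expr01 mu 0 mu_fin) => // x _; rewrite expr0.
- apply: aeW => x n /=; rewrite in_itv/= => /andP[x0 x1].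
  have xn1 : 0 <= 1 - x ^+ n <= 1.
    by rewrite subr_ge0 exprn_ile1// gerBl exprn_ge0.
  by case/andP: xn1 => ? ?; rewrite lee_fin ger0_norm ?exprn_ge0// exprn_ile1.
Qed.

(** Open half-lines form a generating class closed under intersection. For a threshold in []0, 1]]
    their measure is a limit of combinations of moments; for any other threshold the trace on
    [[0, 1]] is empty or everything. *)
Lemma moment_determinacy mu nu : (mu `[0%R, 1%R]%classic < +oo)%E ->
  (forall n, (\int[mu]_(x in `[0%R, 1%R]) (x ^+ n)%:E =
              \int[nu]_(x in `[0%R, 1%R]) (x ^+ n)%:E)%E) ->
  forall A : set R, measurable A -> mu (A `&` `[0%R, 1%R]) = nu (A `&` `[0%R, 1%R]).
Proof.
move=> mu_fin munu.
have m01 : measurable (`[0%R, 1%R]%classic : set R) by exact: measurable_itv.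
have munu01 : mu `[0%R, 1%R]%classic = nu `[0%R, 1%R]%classic.
  have := munu 0%N; under eq_integral do rewrite expr0.
  under [in RHS]eq_integral do rewrite expr0.
  by rewrite !integral_cst// !mul1e.
have nu_fin : (nu `[0%R, 1%R]%classic < +oo)%E by rewrite -munu01.
suff H A : measurable A -> mrestr mu m01 A = mrestr nu m01 A by [].
apply: (measure_unique (@RGenInftyO.G R) (fun n => `]-oo, n%:R[%classic)).
- exact: RGenInftyO.measurableE.
- move=> _ _ [x ->] [y ->]; exists (Num.min x y).
  by apply/seteqP; split=> z /=; rewrite !in_itv/= lt_min => /andP.
- by move=> n; exists n%:R.
- apply/seteqP; split=> // x _; exists (Num.trunc x).+1 => //=.
  by rewrite in_itv/= truncnS_gt.
- move=> _ [x ->].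
  change (mu (`]-oo, x[ `&` `[0%R, 1%R]) = nu (`]-oo, x[ `&` `[0%R, 1%R])).
  have [x0|x0] := leP x 0.
    rewrite (_ : _ `&` _ = set0) ?measure0//; apply/seteqP; split=> // z [] /=.
    by rewrite !in_itv/= => zx /andP[z0 _]; have := lt_le_trans zx x0; rewrite ltNge z0.
  have [x1|x1] := leP x 1.
    have r1 : 1 <= x^-1 by rewrite invf_ge1.
    have h1 := cvg_integral_step mu x^-1 mu_fin r1.
    have h2 := cvg_integral_step nu x^-1 nu_fin r1.
    rewrite invrK in h1 h2; rewrite -(cvg_lim _ h1)// -(cvg_lim _ h2)//; congr (limn _).
    apply/funext => n; rewrite !integral_onemXX//; apply: eq_bigr => i _.
    by rewrite munu.
  rewrite (_ : _ `&` _ = `[0%R, 1%R]%classic)//; apply/seteqP; split=> [z []//|z] /=.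
  by rewrite !in_itv/= => /andP[z0 z1]; rewrite z0 z1 (le_lt_trans z1).
- move=> n; apply: le_lt_trans mu_fin.
  change (mu (`]-oo, n%:R[ `&` `[0%R, 1%R]) <= mu `[0%R, 1%R]%classic)%E.
  exact: measureIr.
Qed.

End moment_determinacy.

Section weighted_determinacy.
Context {R : realType}.

(** Two spaces and two weights are allowed so that one statement compares both sides of a size-bias
    identity, and also a random variable with Lebesgue measure weighted by a Beta density. In the
    latter case the variable lies in [[0, 1]] only where the weight is nonzero. *)
Lemma weighted_moment_determinacy d1 (T1 : measurableType d1) d2 (T2 : measurableType d2)
    (m1 : {measure set T1 -> \bar R}) (m2 : {measure set T2 -> \bar R})
    (h1 X1 : T1 -> R) (h2 X2 : T2 -> R) :
  measurable_fun setT h1 -> measurable_fun setT X1 ->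
  measurable_fun setT h2 -> measurable_fun setT X2 ->
  (forall x, 0 <= h1 x) -> (forall x, 0 <= h2 x) ->
  (forall x, h1 x != 0 -> 0 <= X1 x <= 1) -> (forall x, h2 x != 0 -> 0 <= X2 x <= 1) ->
  (\int[m1]_x (h1 x)%:E < +oo)%E ->
  (forall n, \int[m1]_x (h1 x * X1 x ^+ n)%:E = \int[m2]_x (h2 x * X2 x ^+ n)%:E)%E ->
  forall g : R -> R, measurable_fun (`[0, 1] : set R) g ->
    (forall x, x \in `[0, 1] -> 0 <= g x) ->
  (\int[m1]_x (h1 x * g (X1 x))%:E = \int[m2]_x (h2 x * g (X2 x))%:E)%E.
Proof.
move=> mh1 mX1 mh2 mX2 h10 h20 X101 X201 fin1 mom g mg g0.
have red d (T : measurableType d) (m : {measure set T -> \bar R}) (h X : T -> R) :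
    measurable_fun setT h -> measurable_fun setT X -> (forall x, 0 <= h x) ->
    (forall x, h x != 0 -> 0 <= X x <= 1) ->
    exists nu : {measure set R -> \bar R}, forall f : R -> R,
      measurable_fun (`[0, 1] : set R) f -> (forall x, x \in `[0, 1] -> 0 <= f x) ->
      (\int[nu]_(x in `[0%R, 1%R]) (f x)%:E = \int[m]_x (h x * f (X x))%:E)%E.
  move=> mh mX h0 X01; have [nu nuE] := weighted_law_ex m h X mh h0 mX.
  exists nu => f mf f0; rewrite [LHS]integral_mkcond.
  rewrite nuE.
  - apply: eq_integral => x _; rewrite EFinM patchE.
    have [->|/X01 Xx] := eqVneq (h x) 0; first by rewrite !mul0e.
    by rewrite mem_set//= in_itv.
  - by apply/measurable_restrict => //; rewrite setTI; exact/measurable_EFinP.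
  - move=> x; rewrite patchE; case: ifPn => //; rewrite inE/= => x01.
    by rewrite lee_fin f0.
have [nu1 E1] := red _ _ m1 _ _ mh1 mX1 h10 X101.
have [nu2 E2] := red _ _ m2 _ _ mh2 mX2 h20 X201.
rewrite -E1// -E2//.
have fin : (nu1 `[0%R, 1%R]%classic < +oo)%E.
  rewrite -[X in (X < _)%E]mul1e -integral_cst//= (E1 (cst 1))//.
  by under eq_integral do rewrite mulr1.
have mom' n : (\int[nu1]_(x in `[0%R, 1%R]) (x ^+ n)%:E =
               \int[nu2]_(x in `[0%R, 1%R]) (x ^+ n)%:E)%E.
  rewrite (E1 (fun x => x ^+ n)) ?(E2 (fun x => x ^+ n)) ?mom//.
  - by move=> x; rewrite in_itv/= => /andP[x0 _]; exact: exprn_ge0.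
  - by move=> x; rewrite in_itv/= => /andP[x0 _]; exact: exprn_ge0.
apply: eq_measure_integral => A mA A01.
have := moment_determinacy nu1 nu2 fin mom' A mA.
by rewrite (_ : A `&` _ = A)//; apply/setIidl.
Qed.

End weighted_determinacy.

(** * Beta laws *)

Section beta_law.
Context {R : realType}.
Local Notation mu := (@lebesgue_measure R).
Implicit Types a b : R.

Lemma EFin_Gamma a : 0 < a -> ((Gamma a)%:E = eGamma a)%E.
Proof.
by move=> a0; rewrite fineK// ge0_fin_numE ?eGamma_ge0// eGamma_lty.
Qed.

Lemma Gamma_gt0 a : 0 < a -> 0 < Gamma a.
Proof. by move=> a0; rewrite -lte_fin EFin_Gamma// eGamma_gt0. Qed.

Lemma GammaD a n : 0 < a -> Gamma (a + n%:R) = pochhammer a n * Gamma a.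
Proof.
move=> a0; elim: n => [|n ih]; first by rewrite addr0 pochhammer0 mul1r.
have an0 : 0 < a + n%:R by rewrite ltr_wpDr.
rewrite -natr1 addrA pochhammerS mulrAC -ih mulrC; apply: EFin_inj.
by rewrite EFinM !EFin_Gamma ?eGammaS// addr_gt0.
Qed.

Lemma Beta_gt0 a b : 0 < a -> 0 < b -> 0 < Beta a b.
Proof. by move=> a0 b0; rewrite divr_gt0 ?mulr_gt0 ?Gamma_gt0// addr_gt0. Qed.

(** In [eGamma_eBeta] the left side is finite and [Gamma (a + b) > 0], which excludes an infinite
    [eBeta] and permits the division. *)
Lemma eBetaE a b : 0 < a -> 0 < b -> (eBeta a b = (Beta a b)%:E)%E.
Proof.
move=> a0 b0; have ab0 : 0 < a + b by rewrite addr_gt0.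
have := eGamma_eBeta a b a0 b0; rewrite -!EFin_Gamma// -EFinM.
have : (0 <= eBeta a b)%E.
  by apply: integral_ge0 => x _; rewrite lee_fin mulr_ge0 ?powR_ge0.
have G0 := Gamma_gt0 _ ab0.
case: (eBeta a b) => [r _|_|//].
  by rewrite -EFinM => -[E]; congr EFin; rewrite /Beta E mulrC mulKf ?gt_eqF.
by rewrite gt0_muley ?lte_fin.
Qed.

Lemma BetaD a b i j : 0 < a -> 0 < b ->
  Beta (a + i%:R) (b + j%:R) = beta_moment a b i j * Beta a b.
Proof.
move=> a0 b0; have ab0 : 0 < a + b by rewrite addr_gt0.
rewrite /Beta (_ : a + i%:R + (b + j%:R) = a + b + (i + j)%:R); last by rewrite natrD; ring.
rewrite !GammaD// /beta_moment.
have := Gamma_gt0 _ ab0; have := pochhammer_gt0 (a + b) (i + j) ab0.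
by move=> /gt_eqF h1 /gt_eqF h2; field; rewrite h1 h2.
Qed.

Lemma measurable_Beta_density a b : measurable_fun [set: R] (Beta_density a b).
Proof.
apply: measurable_funM => //; apply: measurable_funM => //.
apply: (@measurableT_comp _ _ _ _ _ _ (fun x : R => x `^ (b - 1))) => //.
exact: measurable_funB.
Qed.

Lemma Beta_density_ge0 a b x : 0 < a -> 0 < b -> 0 <= Beta_density a b x.
Proof.
by move=> a0 b0; rewrite /Beta_density mulr_ge0 ?mulr_ge0 ?powR_ge0// invr_ge0 ltW// Beta_gt0.
Qed.

(** The factor [x^i (1 - x)^j] shifts the parameters to [a + i] and [b + j]; [BetaD] gives the ratio
    of the Beta constants. *)
Lemma integral_Beta_density a b i j : 0 < a -> 0 < b ->
  (\int[mu]_(x in `[0%R, 1%R]) (Beta_density a b x * (x ^+ i * (1 - x) ^+ j))%:E =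
   (beta_moment a b i j)%:E)%E.
Proof.
move=> a0 b0; have B0 := Beta_gt0 _ _ a0 b0.
have ai0 : 0 < a + i%:R by rewrite ltr_wpDr.
have bj0 : 0 < b + j%:R by rewrite ltr_wpDr.
have mbeta c e D : measurable_fun D (fun x : measurableTypeR R =>
    (x `^ (c - 1) * (1 - x) `^ (e - 1))%:E).
  by apply: measurable_funTS; exact: measurable_beta.
transitivity ((Beta a b)^-1%:E * eBeta (a + i%:R) (b + j%:R))%E; last first.
  by rewrite eBetaE// BetaD// -EFinM mulrC mulfK// gt_eqF.
rewrite /eBeta -ge0_integralZl_EFin//; last 2 first.
  by move=> x _; rewrite lee_fin mulr_ge0 ?powR_ge0.
  by rewrite invr_ge0 ltW.
rewrite (@integral_itv_bndoo _ _ _ _ true false); last first.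
  apply/measurable_EFinP/measurable_funTS; apply: measurable_funM.
    exact: measurable_Beta_density.
  apply: measurable_funM; first exact: measurable_funX.
  by apply: measurable_funX; exact: measurable_funB.
rewrite [RHS](@integral_itv_bndoo _ _ _ _ true false); last first.
  by apply: measurable_funeM; exact: mbeta.
apply: eq_integral => x; rewrite inE/= in_itv/= => /andP[x0 x1].
have x1' : 0 < 1 - x by rewrite subr_gt0.
rewrite -EFinM; congr EFin; rewrite /Beta_density -mulrA; congr (_ * _).
have pD (y c : R) k : 0 < y -> y `^ (c + k%:R - 1) = y `^ (c - 1) * y ^+ k.
  move=> y0; rewrite (_ : c + k%:R - 1 = (c - 1) + k%:R); last by ring.
  by rewrite powRD ?(lt0r_neq0 y0) ?implybT// powR_mulrn// ltW.
by rewrite !pD//; ring.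
Qed.

(** [Beta_law] is a bare set function; here it is realised by a genuine measure, against which
    functions can be integrated. *)
Lemma beta_weight_law a b : 0 < a -> 0 < b ->
  exists nu : {measure set R -> \bar R},
    (forall A : set R, measurable A -> nu A = Beta_law a b A) /\
    (forall f : R -> R, measurable_fun (`[0, 1] : set R) f ->
      (forall x, x \in `[0, 1] -> 0 <= f x) ->
      (\int[nu]_(x in `[0%R, 1%R]) (f x)%:E =
       \int[mu]_(x in `[0%R, 1%R]) (Beta_density a b x * f x)%:E)%E).
Proof.
move=> a0 b0.
pose h := Beta_density a b \_ `[0, 1]%classic : R -> R.
have h0 x : 0 <= h x.
  by rewrite /h patchE; case: ifP => // _; exact: Beta_density_ge0.
have mh : measurable_fun [set: R] h.
  apply/measurable_restrict => //; rewrite setTI.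
  by apply: measurable_funTS; exact: measurable_Beta_density.
have [nu nuE] := weighted_law_ex mu h (@idfun R) mh h0 (@measurable_id _ _ _).
exists nu; split => [A mA|f mf f0].
  transitivity (\int[nu]_x (\1_A x)%:E)%E; first by rewrite integral_indic// setIT.
  rewrite nuE//; last exact/measurable_EFinP.
  rewrite /Beta_law [RHS]integral_mkcond; apply: eq_integral => x _.
  rewrite /h !patchE indicE in_setI.
  by case: (x \in A); case: (x \in _) => //=; rewrite ?mule1 ?mule0 ?mul0e.
rewrite [LHS]integral_mkcond nuE.
- rewrite [RHS]integral_mkcond; apply: eq_integral => x _.
  by rewrite /h !patchE; case: ifP => _; rewrite ?mul0e// EFinM.
- by apply/measurable_restrict => //; rewrite setTI; exact/measurable_EFinP.
- by move=> x; rewrite patchE; case: ifP => //; rewrite inE/= => x01; rewrite lee_fin f0.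
Qed.

Context {d} {T : measurableType d} {P : probability T R} (X : {RV P >-> R})
  (X01 : forall t, X t \in `[0, 1]).

Lemma Beta_distributed_moments a b : 0 < a -> 0 < b -> Beta_distributed P X a b ->
  forall i j, (\int[P]_t (X t ^+ i * (1 - X t) ^+ j)%:E = (beta_moment a b i j)%:E)%E.
Proof.
move=> a0 b0 XB i j; have [nu [nuA nuf]] := beta_weight_law a b a0 b0.
pose f x : R := x ^+ i * (1 - x) ^+ j.
have mf : measurable_fun [set: R] f.
  apply: measurable_funM; first exact: measurable_funX.
  by apply: measurable_funX; exact: measurable_funB.
have f0 x : x \in `[0, 1] -> 0 <= f x.
  by rewrite in_itv/= => /andP[x0 x1]; rewrite mulr_ge0 ?exprn_ge0// subr_ge0.
rewrite -(integral_Beta_density a b i j a0 b0) -(nuf f)//; last exact: measurable_funTS.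
transitivity (\int[distribution P X]_(x in `[0%R, 1%R]) (f x)%:E)%E; last first.
  apply: eq_measure_integral => A mA _.
  by rewrite nuA//; exact: XB.
rewrite ge0_integral_pushforward//.
- rewrite (_ : _ @^-1` _ = setT)//; apply/seteqP; split => // t _ /=; exact: X01.
- by apply/measurable_EFinP; exact: measurable_funTS.
- by move=> y; rewrite inE/= => /f0; rewrite lee_fin.
Qed.

(** Moments of [1 - X] are the form in which rigidity delivers [e 0 n] and [c n]. Determinacy is
    applied to [1 - X], and the test function [\1_A (1 - x)] brings the conclusion back to [X]. *)
Lemma Beta_distributed_of_moments a b : 0 < a -> 0 < b ->
  (forall n, \int[P]_t ((1 - X t) ^+ n)%:E = (beta_moment a b 0 n)%:E)%E ->
  Beta_distributed P X a b.
Proof.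
move=> a0 b0 mom A mA.
pose h := Beta_density a b \_ `[0, 1]%classic : R -> R.
have h0 x : 0 <= h x.
  by rewrite /h patchE; case: ifP => // _; exact: Beta_density_ge0.
have mh : measurable_fun [set: R] h.
  apply/measurable_restrict => //; rewrite setTI.
  by apply: measurable_funTS; exact: measurable_Beta_density.
have hM (f : R -> R) : (\int[mu]_x (h x * f x)%:E =
    \int[mu]_(x in `[0%R, 1%R]) (Beta_density a b x * f x)%:E)%E.
  rewrite [RHS]integral_mkcond; apply: eq_integral => x _.
  by rewrite /h !patchE; case: ifP => // _; rewrite mul0r.
have h01 (x : R) : h x != 0 -> 0 <= 1 - x <= 1.
  rewrite /h patchE; case: ifP; last by rewrite eqxx.
  by rewrite inE/= in_itv/= subr_ge0 gerBl => /andP[-> ->].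
have X01' t : (1 : R) != 0 -> 0 <= 1 - X t <= 1.
  by have := X01 t; rewrite in_itv/= subr_ge0 gerBl => /andP[-> ->].
have mX1 : measurable_fun setT (fun t => 1 - X t) by apply: measurable_funB.
have m1 : measurable_fun [set: R] (fun x : R => 1 - x) by exact: measurable_funB.
have fin : (\int[P]_x (cst (1 : R) x)%:E < +oo)%E.
  rewrite (_ : (fun x => _) = cst 1%E)// integral_cst// mul1e.
  by rewrite (le_lt_trans (probability_le1 _ _))// ltry.
have mom' n : (\int[P]_t (1 * (1 - X t) ^+ n)%:E = \int[mu]_x (h x * (1 - x) ^+ n)%:E)%E.
  under eq_integral do rewrite mul1r.
  rewrite mom hM -integral_Beta_density//.
  by apply: eq_integral => x _; rewrite mul1r.
have := weighted_moment_determinacy _ T _ (measurableTypeR R) P mu (cst 1) (fun t => 1 - X t)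
  h (fun x => 1 - x) (measurable_cst _) mX1 mh m1 (fun=> ler01) h0 X01' h01 fin mom'
  (fun x => \1_A (1 - x)).
have mA1 : measurable_fun [set: R] (fun x : R => \1_A (1 - x) : R).
  by apply: (@measurableT_comp _ _ _ _ _ _ (\1_A : R -> R)) => //; exact: measurable_indic.
move=> /(_ (measurable_funTS mA1)).
have i0 (x : R) : x \in `[0, 1] -> 0 <= \1_A (1 - x) :> R by rewrite indicE.
move=> /(_ i0) E.
rewrite /distribution /pushforward /=.
transitivity (\int[P]_t (1 * \1_A (1 - (1 - X t)))%:E)%E.
  rewrite -(setIT (X @^-1` A)) -integral_indic//; last exact: measurable_funPTI.
  by apply: eq_integral => t _; rewrite mul1r opprB addrC subrK.
rewrite {}E hM /Beta_law setIC integral_mkcondr; apply: eq_integral => x _.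
rewrite patchE opprB addrC subrK indicE.
by case: ifP => _; rewrite ?mulr1 ?mulr0.
Qed.

End beta_law.

Lemma Beta_rv_ex {R : realType} (a b : R) : 0 < a -> 0 < b ->
  exists (Q : probability R R) (X : {RV Q >-> R}),
    (forall t, X t \in `[0, 1]) /\ Beta_distributed Q X a b.
Proof.
move=> a0 b0; have [nu [nuA nuf]] := beta_weight_law a b a0 b0.
have nuT : nu setT = 1%E.
  rewrite nuA// /Beta_law setTI.
  have := integral_Beta_density a b 0 0 a0 b0.
  rewrite /beta_moment !pochhammer0 mulr1 divr1 => <-.
  by apply: eq_integral => x _; rewrite !mulr1.
(* The mass of [nu] is already [1], so normalising only supplies the probability structure; the
   Dirac mass is its default for degenerate total mass. *)
pose Q : probability R R := mnormalize nu (dirac (0 : R)).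
have QE A : Q A = nu A.
  by rewrite /Q /= /mnormalize /= nuT onee_eq0 /= invr1 mule1.
(* Values in [[0, 1]] are demanded everywhere, not almost surely, so the identity is clamped; points
   of [[0, 1]] stay fixed. *)
have mclip : measurable_fun [set: R] (fun x : R => Num.max 0 (Num.min 1 x)).
  by apply: measurable_maxr => //; exact: measurable_minr.
pose X : {RV Q >-> R} := HB.pack (fun x : R => Num.max 0 (Num.min 1 x))
  (isMeasurableFun.Build _ _ _ _ _ mclip).
exists Q, X; split => [t|A mA].
  by rewrite in_itv/= le_max lexx/= ge_max ler01 ge_min lexx.
change (Q (X @^-1` A) = Beta_law a b A); rewrite QE nuA; last exact: measurable_funPTI.
rewrite /Beta_law; congr (integral _ _ _).
apply/seteqP; split=> x [] /=; rewrite in_itv/= => Ax /andP[x0 x1];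
by move: Ax; rewrite (min_idPr x1) (max_idPr x0) x0 x1.
Qed.

(** * Size-bias identities *)

Section independence.
Context {d} {T : measurableType d} {R : realType} {P : probability T R}.

(** Independence says that the joint law agrees with the product law on rectangles, hence
    everywhere; Tonelli then splits the integral. *)
Lemma independent_rv_integralM (X Y : {RV P >-> R}) (f g : R -> R) :
  independent_rv P X Y -> measurable_fun setT f -> measurable_fun setT g ->
  (forall t, 0 <= f (X t)) -> (forall t, 0 <= g (Y t)) ->
  (\int[P]_t (f (X t) * g (Y t))%:E =
   \int[P]_t (f (X t))%:E * \int[P]_t (g (Y t))%:E)%E.
Proof.
move=> indep mf mg f0 g0.
(* Nonnegativity is known only along [X] and [Y]; absolute values provide it on the whole line, for
   Tonelli, without changing the integrals. *)
pose f' (x : R) : R := `|f x|; pose g' (x : R) : R := `|g x|.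
have mf' : measurable_fun setT (EFin \o f') by apply/measurable_EFinP; exact: measurableT_comp.
have mg' : measurable_fun setT (EFin \o g') by apply/measurable_EFinP; exact: measurableT_comp.
have f'0 x : (0 <= (EFin \o f') x)%E by rewrite /= lee_fin normr_ge0.
have g'0 x : (0 <= (EFin \o g') x)%E by rewrite /= lee_fin normr_ge0.
have -> : (\int[P]_t (f (X t))%:E = \int[distribution P X]_x (f' x)%:E)%E.
  rewrite ge0_integral_distribution//.
  by apply: eq_integral => t _ /=; rewrite /f' ger0_norm.
have -> : (\int[P]_t (g (Y t))%:E = \int[distribution P Y]_x (g' x)%:E)%E.
  rewrite ge0_integral_distribution//.
  by apply: eq_integral => t _ /=; rewrite /g' ger0_norm.
have mXY : measurable_fun setT (fun t => (X t, Y t)) by exact: measurable_fun_pair.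
pose h (z : R * R) := (f' z.1 * g' z.2)%:E.
have h0 z : (0 <= h z)%E by rewrite lee_fin mulr_ge0 ?normr_ge0.
have mh : measurable_fun setT h.
  apply/measurable_EFinP; apply: measurable_funM.
    by apply: (measurableT_comp (f := f')); [exact/measurable_EFinP|exact: measurable_fst].
  by apply: (measurableT_comp (f := g')); [exact/measurable_EFinP|exact: measurable_snd].
transitivity (\int[P]_t h (X t, Y t))%E.
  by apply: eq_integral => t _; rewrite /h /f' /g' /= !ger0_norm.
unshelve epose (m := pushforward P (fun t => (X t, Y t)) : {measure set (R * R) -> \bar R});
  first exact: mXY.
transitivity (\int[m]_z h z)%E.
  by rewrite /m ge0_integral_pushforward.
transitivity (\int[(distribution P X \x distribution P Y)%E]_z h z)%E.
  apply: eq_measure_integral => A mA _; apply/esym.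
  by apply: product_measure_unique => // B C mB mC; exact: indep.
rewrite fubini_tonelli1// /fubini_F/=.
transitivity (\int[distribution P X]_x
    ((f' x)%:E * \int[distribution P Y]_y (g' y)%:E))%E.
  apply: eq_integral => x _; rewrite -ge0_integralZl//.
    by move=> y _; exact: g'0.
  by rewrite lee_fin normr_ge0.
rewrite ge0_integralZr//; first by move=> x _; exact: f'0.
by apply: integral_ge0 => y _; exact: g'0.
Qed.

Lemma integral01_fin_num (f : T -> R) : measurable_fun setT f ->
  (forall t, 0 <= f t <= 1) -> (\int[P]_t (f t)%:E)%E \is a fin_num.
Proof.
move=> mf f01; apply: integrable_fin_num => //.
apply: (@measurable_bounded_integrable _ _ _ P f) => //.
  by rewrite (le_lt_trans (probability_le1 _ _))// ltry.
exists 1; split; first exact: num_real.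
move=> M M1 t _; have /andP[ft0 ft1] := f01 t.
by rewrite /= ger0_norm// (le_trans ft1)// ltW.
Qed.

End independence.

Lemma onem_itv01 {T : Type} {R : realType} (V : T -> R) : (forall t, V t \in `[0, 1]) ->
  forall t, 1 - V t \in `[0, 1].
Proof.
by move=> V01 t; have := V01 t; rewrite !in_itv/= subr_ge0 gerBl => /andP[-> ->].
Qed.

Lemma expr_itv01 {T : Type} {R : realType} (V : T -> R) n : (forall t, V t \in `[0, 1]) ->
  forall t, 0 <= V t ^+ n <= 1.
Proof.
move=> V01 t; have := V01 t; rewrite in_itv/= => /andP[v0 v1].
by rewrite exprn_ge0// exprn_ile1.
Qed.

Lemma measurable_onemX {R : realType} n : measurable_fun [set: R] (fun x : R => (1 - x) ^+ n).
Proof. by apply: measurable_funX; exact: measurable_funB. Qed.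

(** * The identities for an independent pair on one space *)

Section size_bias.
Context {d} {T : measurableType d} {R : realType} {P : probability T R}.
Context (U W : {RV P >-> R}) (U01 : forall t, U t \in `[0, 1])
  (W01 : forall t, W t \in `[0, 1]) (indep : independent_rv P U W).

Let mU : measurable_fun setT U. Proof. exact: measurable_funPT. Qed.
Let mW : measurable_fun setT W. Proof. exact: measurable_funPT. Qed.
Let mU1 : measurable_fun setT (fun t => 1 - U t). Proof. exact: measurable_funB. Qed.
Let mW1 : measurable_fun setT (fun t => 1 - W t). Proof. exact: measurable_funB. Qed.
Let U101 := onem_itv01 U U01.
Let W101 := onem_itv01 W W01.

Lemma integral_prodU n : (\int[P]_t (((1 - W t) * U t) ^+ n)%:E =
  \int[P]_t ((1 - W t) ^+ n)%:E * \int[P]_t (U t ^+ n)%:E)%E.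
Proof.
rewrite muleC -(independent_rv_integralM U W (fun x => x ^+ n) (fun x => (1 - x) ^+ n))//.
- by apply: eq_integral => t _; rewrite exprMn mulrC.
- exact: measurable_onemX.
- by move=> t; case/andP: (expr_itv01 U n U01 t).
- by move=> t; case/andP: (expr_itv01 _ n W101 t).
Qed.

(** This is the moment in the first identity at [g x = (1 - x)^n], since
    [1 - ((1 - W) U + W) = (1 - W) (1 - U)]. *)
Lemma integral_prodU1 n : (\int[P]_t (((1 - W t) * (1 - U t)) ^+ n)%:E =
  \int[P]_t ((1 - W t) ^+ n)%:E * \int[P]_t ((1 - U t) ^+ n)%:E)%E.
Proof.
rewrite muleC -(independent_rv_integralM U W (fun x => (1 - x) ^+ n) (fun x => (1 - x) ^+ n))//.
- by apply: eq_integral => t _; rewrite exprMn mulrC.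
- exact: measurable_onemX.
- exact: measurable_onemX.
- by move=> t; case/andP: (expr_itv01 _ n U101 t).
- by move=> t; case/andP: (expr_itv01 _ n W101 t).
Qed.

(** The first identity is read in the variable [1 - U] with test function [g (1 - x)], so that its
    right-hand variable is a product; the second already has this form. *)
Lemma size_bias_beta (a b : R) : 0 < a -> 0 < b ->
  Beta_distributed P U a b -> Beta_distributed P W 1 (a + b) ->
  size_bias_identities P U W (a / (a + b)).
Proof.
move=> a0 b0 UB WB g mg g0; have ab0 : 0 < a + b by rewrite addr_gt0.
have abn0 : a + b != 0 by rewrite gt_eqF.
have Umom := Beta_distributed_moments U U01 a b a0 b0 UB.
have Wmom n : (\int[P]_t ((1 - W t) ^+ n)%:E = ((a + b) / (a + b + n%:R))%:E)%E.
  rewrite -beta_moment_1// -(Beta_distributed_moments W W01 1 (a + b) ltr01 ab0 WB 0 n).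
  by apply: eq_integral => t _; rewrite expr0 mul1r.
have abnn n : a + b + n%:R != 0 by rewrite gt_eqF// ltr_wpDr.
have q0 : 0 <= 1 - a / (a + b).
  by rewrite subr_ge0 ler_pdivrMr// mul1r lerDl ltW.
have p0 : 0 <= a / (a + b) by rewrite divr_ge0// ltW.
have itv01 : measurable (`[0, 1]%classic : set R) by exact: measurable_itv.
have prod01 (x y : R) : x \in `[0, 1] -> y \in `[0, 1] -> x * y \in `[0, 1].
  rewrite !in_itv/= => /andP[x0 x1] /andP[y0 y1].
  by rewrite mulr_ge0// mulr_ile1.
have to01 (x : R) : x \in `[0, 1] -> 0 <= x <= 1 by rewrite in_itv.
have mcomp (V : T -> R) : measurable_fun setT V -> (forall t, V t \in `[0, 1]) ->
    measurable_fun setT (fun t => g (V t)).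
  move=> mV V01; apply: (measurable_comp itv01 _ mg mV).
  by move=> _ [t _ <-] /=; exact: V01.
have fin (h : T -> R) : measurable_fun setT h -> (forall t, h t \in `[0, 1]) ->
    (\int[P]_t (h t)%:E < +oo)%E.
  move=> mh h01; have : (\int[P]_t (h t)%:E)%E \is a fin_num.
    by apply: integral01_fin_num => // t; exact: to01.
  by rewrite fin_numElt => /andP[].
rewrite !unlock; split.
- have mg1 : measurable_fun (`[0, 1] : set R) (fun x => g (1 - x)).
    apply: (measurable_comp itv01 _ mg); last exact: measurable_funB.
    by move=> _ [x /= x01 <-]; rewrite !in_itv/= in x01 *; rewrite subr_ge0 gerBl andbC.
  have g10 (x : R) : x \in `[0, 1] -> 0 <= g (1 - x).
    by move=> x01; apply: g0; move: x01; rewrite !in_itv/= subr_ge0 gerBl andbC.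
  have mWU : measurable_fun setT (fun t => (1 - W t) * (1 - U t)).
    exact: measurable_funM.
  have := weighted_moment_determinacy _ T _ T P P U (fun t => 1 - U t)
    (cst (a / (a + b))) (fun t => (1 - W t) * (1 - U t))
    mU mU1 (measurable_cst _) mWU.
  move=> /(_ (fun t => (andP (to01 _ (U01 t))).1) (fun=> p0)
    (fun t _ => to01 _ (U101 t)) (fun t _ => to01 _ (prod01 _ _ (W101 t) (U101 t)))
    (fin _ mU U01)).
  have mom n : (\int[P]_t (U t * (1 - U t) ^+ n)%:E =
      \int[P]_t (cst (a / (a + b)) t * ((1 - W t) * (1 - U t)) ^+ n)%:E)%E.
    have := Umom 1%N n; under eq_integral do rewrite expr1.
    move=> ->; under eq_integral do rewrite /cst EFinM.
    rewrite ge0_integralZl//; last 2 first.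
      by apply/measurable_EFinP; exact: measurable_funX.
      by move=> t _; rewrite lee_fin exprn_ge0// mulr_ge0//;
        [case/andP: (to01 _ (W101 t))|case/andP: (to01 _ (U101 t))].
    rewrite integral_prodU1 Wmom.
    have := Umom 0%N n; under eq_integral do rewrite expr0 mul1r.
    move=> ->; rewrite -!EFinM; congr EFin.
    (* The product of [a / (a + b)] and [(a + b) / (a + b + n)] is the ratio of
       [beta_moment a b 1 n] to [beta_moment a b 0 n]. *)
    rewrite (beta_momentC a b 1) beta_moment_S1// (addrC b) -(beta_momentC a b 0).
    by field; rewrite abn0 abnn.
  move=> /(_ mom _ mg1 g10) E.
  transitivity (\int[P]_t (U t * g (1 - (1 - U t)))%:E)%E.
    by apply: eq_integral => t _; rewrite subKr mulrC.
  rewrite {}E -ge0_integralZl//.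
  + apply: eq_integral => t _; rewrite -EFinM; congr (_ * g _)%:E; ring.
  + apply/measurable_EFinP; apply: (mcomp (fun t => (1 - W t) * U t + W t)).
      by apply: measurable_funD => //; exact: measurable_funM.
    move=> t; have := prod01 _ _ (W101 t) (U101 t); rewrite !in_itv/= => /andP[h1 h2].
    apply/andP; split; lra.
  + move=> t _; rewrite lee_fin; apply: g0.
    have := prod01 _ _ (W101 t) (U101 t); rewrite !in_itv/= => /andP[h1 h2].
    apply/andP; split; lra.
- have mWU : measurable_fun setT (fun t => (1 - W t) * U t).
    exact: measurable_funM.
  have := weighted_moment_determinacy _ T _ T P P (fun t => 1 - U t) U
    (cst (1 - a / (a + b))) (fun t => (1 - W t) * U t)
    mU1 mU (measurable_cst _) mWU.
  move=> /(_ (fun t => (andP (to01 _ (U101 t))).1) (fun=> q0)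
    (fun t _ => to01 _ (U01 t)) (fun t _ => to01 _ (prod01 _ _ (W101 t) (U01 t)))
    (fin _ mU1 U101)).
  have mom n : (\int[P]_t ((1 - U t) * U t ^+ n)%:E =
      \int[P]_t (cst (1 - a / (a + b)) t * ((1 - W t) * U t) ^+ n)%:E)%E.
    have := Umom n 1%N; under eq_integral do rewrite expr1 mulrC.
    move=> ->; under eq_integral do rewrite /cst EFinM.
    rewrite ge0_integralZl//; last 2 first.
      by apply/measurable_EFinP; exact: measurable_funX.
      by move=> t _; rewrite lee_fin exprn_ge0// mulr_ge0//;
        [case/andP: (to01 _ (W101 t))|case/andP: (to01 _ (U01 t))].
    rewrite integral_prodU Wmom.
    have := Umom n 0%N; under eq_integral do rewrite expr0 mulr1.
    move=> ->; rewrite -!EFinM; congr EFin.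
    rewrite beta_moment_S1//.
    by field; rewrite abn0 abnn.
  move=> /(_ mom _ mg g0) E.
  transitivity (\int[P]_t ((1 - U t) * g (U t))%:E)%E.
    by apply: eq_integral => t _; rewrite mulrC.
  rewrite {}E -ge0_integralZl//.
  + apply/measurable_EFinP; apply: (mcomp (fun t => (1 - W t) * U t)) => // t.
    exact: prod01.
  + by move=> t _; rewrite lee_fin; apply: g0; exact: prod01.
Qed.

Lemma beta_of_size_bias (p : R) :
  (0 < 'E_P[W] < 1)%E -> 0 < p < 1 -> p <> 1 / 2 -> size_bias_identities P U W p ->
  let w := fine 'E_P[W]%E in
  let al := (1 - w) / w in
  [/\ 0 < al, Beta_distributed P U (p * al) ((1 - p) * al) & Beta_distributed P W 1 al].
Proof.
rewrite [in (0 < _ < 1)%E]unlock [in fine _]unlock.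
move=> EW p01 p12 SB w al.
have wE : (w%:E = \int[P]_t (W t)%:E)%E.
  by rewrite /w fineK// fin_real//; case/andP: EW => W0 W1;
     rewrite (lt_trans _ W0) ?ltNy0//= (lt_trans W1)// ltry.
have /andP[w0 w1] : 0 < w < 1 by rewrite -!lte_fin wE.
have al0 : 0 < al by rewrite divr_gt0// subr_gt0.
have to01 (x : R) : x \in `[0, 1] -> 0 <= x <= 1 by rewrite in_itv.
pose e i j := fine (\int[P]_t (U t ^+ i * (1 - U t) ^+ j)%:E).
pose c n := fine (\int[P]_t ((1 - W t) ^+ n)%:E).
have me i j : measurable_fun setT (fun t => U t ^+ i * (1 - U t) ^+ j).
  by apply: measurable_funM; exact: measurable_funX.
have e01 i j t : 0 <= U t ^+ i * (1 - U t) ^+ j <= 1.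
  have /andP[u0 u1] := expr_itv01 U i U01 t; have /andP[v0 v1] := expr_itv01 _ j U101 t.
  by rewrite mulr_ge0// mulr_ile1.
have eE i j : ((e i j)%:E = \int[P]_t (U t ^+ i * (1 - U t) ^+ j)%:E)%E.
  by rewrite fineK//; apply: integral01_fin_num.
have cE n : ((c n)%:E = \int[P]_t ((1 - W t) ^+ n)%:E)%E.
  by rewrite fineK//; apply: integral01_fin_num; [exact: measurable_funX|exact: expr_itv01].
have en0 n : ((e n 0%N)%:E = \int[P]_t (U t ^+ n)%:E)%E.
  by rewrite eE; apply: eq_integral => t _; rewrite expr0 mulr1.
have e0n n : ((e 0%N n)%:E = \int[P]_t ((1 - U t) ^+ n)%:E)%E.
  by rewrite eE; apply: eq_integral => t _; rewrite expr0 mul1r.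
have int1 : (\int[P]_t 1 = 1 :> \bar R)%E.
  have := integral_cst P measurableT 1%E.
  by rewrite mul1e => ->; exact: probability_setT.
have [] // := moments_rigid p al e c p01 p12 al0.
- apply: EFin_inj; rewrite en0; under eq_integral do rewrite expr0.
  exact: int1.
- move=> i j; apply: EFin_inj; rewrite EFinD !eE -ge0_integralD//.
  + by apply: eq_integral => t _; rewrite -EFinD; congr EFin; rewrite !exprS; ring.
  + by move=> t _; rewrite lee_fin; case/andP: (e01 i.+1 j t).
  + exact/measurable_EFinP.
  + by move=> t _; rewrite lee_fin; case/andP: (e01 i j.+1 t).
  + exact/measurable_EFinP.
- move=> n; apply: EFin_inj; rewrite eE.
  have [|x|_] := SB (fun x => x ^+ n); first exact: measurable_funX.
    by rewrite in_itv/= => /andP[x0 _]; exact: exprn_ge0.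
  rewrite !unlock; under eq_integral do rewrite -[X in (_ * X)%R]expr1.
  by move=> ->; rewrite integral_prodU -cE -en0 !EFinM muleA.
- move=> n; apply: EFin_inj; rewrite eE.
  have [|x|+ _] := SB (fun x => (1 - x) ^+ n).
  + by apply: measurable_funTS; exact: measurable_onemX.
  + by rewrite in_itv/= => /andP[_ x1]; rewrite exprn_ge0// subr_ge0.
  rewrite !unlock => E.
  transitivity (\int[P]_t ((1 - U t) ^+ n * U t)%:E)%E.
    by apply: eq_integral => t _; rewrite expr1 mulrC.
  rewrite E (_ : (\int[P]_t _)%E = (\int[P]_t (((1 - W t) * (1 - U t)) ^+ n)%:E)%E).
    by rewrite integral_prodU1 -cE -e0n !EFinM muleA.
  by apply: eq_integral => t _; congr (_ ^+ n)%:E; ring.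
- apply: EFin_inj; rewrite cE; under eq_integral do rewrite expr0.
  exact: int1.
(* From [c 1 = 1 - w] and [al + 1 = 1 / w] one gets [c 1 = al / (al + 1)]; this is where the formula
   for [al] comes from. *)
- have : w + c 1%N = 1.
    apply: EFin_inj; rewrite EFinD wE cE -ge0_integralD//.
    + under eq_integral do rewrite -EFinD expr1 addrC subrK.
      exact: int1.
    + by move=> t _; rewrite lee_fin; case/andP: (to01 _ (W01 t)).
    + exact/measurable_EFinP.
    + by move=> t _; rewrite lee_fin; case/andP: (expr_itv01 _ 1 W101 t).
    + by apply/measurable_EFinP; exact: measurable_funX.
  move=> /eqP; rewrite addrC eq_sym -subr_eq => /eqP <-.
  by rewrite /al; field; rewrite subrK oner_neq0 gt_eqF.
move=> cn eij; split => //.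
- case/andP: (p01) => p0 p1; apply: Beta_distributed_of_moments => //.
  + exact: mulr_gt0.
  + by rewrite mulr_gt0// subr_gt0.
  + by move=> n; rewrite -e0n eij.
- by apply: Beta_distributed_of_moments => // n; rewrite -cE cn beta_moment_1.
Qed.

End size_bias.

(** Since [pi] carries [P'] to [P], reading [Z] on the larger space leaves its law unchanged. [U]
    stands for [Z \o pi] packed as a random variable. *)
Lemma Beta_distributed_enlargement {R : realType} {d d'} {T : measurableType d}
    {T' : measurableType d'} {P : probability T R} {P' : probability T' R}
    (pi : {mfun T' >-> T}) (Z : {RV P >-> R}) (U : {RV P' >-> R}) (a b : R) :
  enlargement P P' pi -> Z \o pi =1 U ->
  Beta_distributed P' U a b <-> Beta_distributed P Z a b.
Proof.
move=> enl ZU.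
have E (A : set R) : measurable A -> distribution P' U A = distribution P Z A.
  move=> mA; rewrite /distribution /pushforward -enl; last exact: measurable_funPTI.
  by rewrite /distribution /pushforward -comp_preimage; congr (P' _); apply/seteqP;
     split=> t /=; rewrite -ZU.
by split=> H A mA; rewrite -H// E.
Qed.

Lemma beta_of_characterizing_pair {R : realType} {d d'} {T : measurableType d}
    {T' : measurableType d'} {P : probability T R} {P' : probability T' R}
    (pi : {mfun T' >-> T}) (Z : {RV P >-> R}) (W : {RV P' >-> R}) (p : R) :
  (forall t, Z t \in `[0, 1]) ->
  enlargement P P' pi -> characterizing_pair P P' pi Z W p ->
  let w := fine 'E_P'[W]%E in
  let al := (1 - w) / w in
  [/\ 0 < al, Beta_distributed P Z (p * al) ((1 - p) * al) & Beta_distributed P' W 1 al].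
Proof.
move=> Z01 enl [W01 indep EW [p01 p12] SB].
have mU : measurable_fun setT (Z \o pi) by exact: measurableT_comp.
pose U : {RV P' >-> R} := HB.pack (Z \o pi) (isMeasurableFun.Build _ _ _ _ _ mU).
have U01 t : U t \in `[0, 1] by exact: Z01.
have [al0 UB WB] := beta_of_size_bias U W U01 W01 indep p EW p01 p12 SB.
split=> //; exact/(Beta_distributed_enlargement pi Z U _ _ enl (fun=> erefl)).
Qed.

Lemma characterizing_pair_of_beta {R : realType} {d} {T : measurableType d}
    {P : probability T R} (Z : {RV P >-> R}) (a b : R) :
  (forall t, Z t \in `[0, 1]) -> ('E_P[Z] <> (1 / 2)%R%:E)%E ->
  0 < a -> 0 < b -> Beta_distributed P Z a b ->
  exists (d' : measure_display) (T' : measurableType d')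
    (P' : probability T' R) (pi : {mfun T' >-> T}) (W : {RV P' >-> R}) (p : R),
    enlargement P P' pi /\ characterizing_pair P P' pi Z W p.
Proof.
move=> Z01 EZ a0 b0 ZB; have ab0 : 0 < a + b by rewrite addr_gt0.
have abn0 : a + b != 0 by rewrite gt_eqF.
have [Q [W0 [W001 W0B]]] := Beta_rv_ex 1 (a + b) ltr01 ab0.
(* On a product with a Beta space the coordinates are independent and the first projection is an
   enlargement. *)
pose P' : probability (T * R)%type R := (P \x Q)%E.
have P'E (A : set T) (B : set R) : measurable A -> measurable B ->
    P' (A `*` B) = (P A * Q B)%E by exact: product_measure1E.
pose pi : {mfun (T * R)%type >-> T} :=
  HB.pack (fun z : T * R => z.1) (isMeasurableFun.Build _ _ _ _ _ (@measurable_fst _ _ T R)).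
have mW : measurable_fun setT (fun z : T * R => W0 z.2).
  by apply: measurableT_comp => //; exact: measurable_snd.
pose W : {RV P' >-> R} := HB.pack (fun z : T * R => W0 z.2)
  (isMeasurableFun.Build _ _ _ _ _ mW).
have mU : measurable_fun setT (Z \o pi) by exact: measurableT_comp.
pose U : {RV P' >-> R} := HB.pack (Z \o pi) (isMeasurableFun.Build _ _ _ _ _ mU).
have fstE (A : set T) : measurable A -> P' (fst @^-1` A) = P A.
  move=> mA; rewrite (_ : fst @^-1` A = A `*` setT); last first.
    by apply/seteqP; split=> z /=; tauto.
  by rewrite P'E// probability_setT mule1.
have sndE (B : set R) : measurable B -> P' (snd @^-1` B) = Q B.
  move=> mB; rewrite (_ : snd @^-1` B = setT `*` B); last first.
    by apply/seteqP; split=> z /=; tauto.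
  by rewrite P'E// probability_setT mul1e.
have enl : enlargement P P' pi by move=> A mA; exact: fstE.
have WB : Beta_distributed P' W 1 (a + b).
  move=> A mA; rewrite -W0B//.
  by apply: (sndE (W0 @^-1` A)); exact: measurable_funPTI.
have UB : Beta_distributed P' U a b.
  by apply/(Beta_distributed_enlargement pi Z U _ _ enl (fun=> erefl)).
have W01 t : W t \in `[0, 1] by exact: W001.
have U01 t : U t \in `[0, 1] by exact: Z01.
have indep : independent_rv P' U W.
  move=> A B mA mB.
  have mZA : measurable (Z @^-1` A) by exact: measurable_funPTI.
  have mWB : measurable (W0 @^-1` B) by exact: measurable_funPTI.
  have := P'E _ _ mZA mWB; rewrite -(fstE _ mZA) -(sndE _ mWB) => <-.
  by congr (P' _); apply/seteqP; split.
(* The first identity at [g = 1] forces [p = E Z], which is [a / (a + b)] here; thus [E Z <> 1/2]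
   yields the condition on [p]. *)
exists _, (T * R)%type, P', pi, W, (a / (a + b)); split => //; split => //.
- have := Beta_distributed_moments W W01 1 (a + b) ltr01 ab0 WB 1 0.
  rewrite /beta_moment addn0 !pochhammerS !pochhammer0 !mul1r !addr0 mulr1 div1r => E.
  have ab1 : 0 < 1 + (a + b) by rewrite addr_gt0.
  rewrite unlock (_ : (\int[P']_t (W t)%:E)%E = (1 + (a + b))^-1%:E).
    by rewrite !lte_fin invr_gt0 ab1/= invf_lt1// ltrDl.
  by rewrite -[RHS]E; apply: eq_integral => t _; rewrite expr1 expr0 mulr1.
- split.
    by rewrite divr_gt0//= ltr_pdivrMr// mul1r ltrDl.
  move=> pE; apply: EZ; rewrite -pE unlock.
  have := Beta_distributed_moments Z Z01 a b a0 b0 ZB 1 0.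
  rewrite /beta_moment addn0 !pochhammerS !pochhammer0 !mul1r !addr0 mulr1 => <-.
  by apply: eq_integral => t _; rewrite expr1 expr0 mulr1.
- exact: (size_bias_beta U W U01 W01 indep a b a0 b0 UB WB).
Qed.

Theorem theorem3p1 (R : realType) (d : measure_display) (T : measurableType d)
    (P : probability T R) (Z : {RV P >-> R})
    (Z01 : forall t, Z t \in `[0, 1])
    (EZ : ('E_P[Z] <> (1 / 2)%R%:E)%E) :
  ((exists a b : R, [/\ 0 < a, 0 < b & Beta_distributed P Z a b])
   <->
   (exists (d' : measure_display) (T' : measurableType d')
      (P' : probability T' R) (pi : {mfun T' >-> T}) (W : {RV P' >-> R})
      (p : R),
      enlargement P P' pi /\ characterizing_pair P P' pi Z W p))
  /\
  (forall (d' : measure_display) (T' : measurableType d')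
      (P' : probability T' R) (pi : {mfun T' >-> T}) (W : {RV P' >-> R})
      (p : R),
      enlargement P P' pi -> characterizing_pair P P' pi Z W p ->
      let w : R := fine 'E_P'[W]%E in
      let alpha : R := (1 - w) / w in
      Beta_distributed P Z (p * alpha) ((1 - p) * alpha) /\
      Beta_distributed P' W 1 alpha).

Proof.
split=> [|d' T' P' pi W p enl cp]; last first.
  by have [_ ? ?] := beta_of_characterizing_pair pi Z W p Z01 enl cp.
split=> [[a [b [a0 b0 ZB]]]|[d' [T' [P' [pi [W [p [enl cp]]]]]]]].
  exact: characterizing_pair_of_beta Z a b Z01 EZ a0 b0 ZB.
have [al0 ZB _] := beta_of_characterizing_pair pi Z W p Z01 enl cp.
have [_ _ _ [/andP[p0 p1] _] _] := cp.
by do 2 eexists; split; [| |exact: ZB]; rewrite mulr_gt0// subr_gt0.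
Qed.
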